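(* The following identity holds: $$\int_{0}^{\infty}\frac{\operatorname{Im}\!\left(\zeta\!\left(\frac12+iv\right)\right)}{\cosh(\pi v)}\,v\,dv=-\frac32+\frac{\pi^{2}}{6}-\frac{\gamma}{2}.$$
   Context: $\zeta$ is the Riemann zeta function and $\gamma$ is the Euler–Mascheroni constant. *)

(* Defs.v *)
From Stdlib Require Import Reals.
From Coquelicot Require Import Coquelicot.

Open Scope R_scope.

Definition Cexp (z : C) : C := (exp (Re z) * cos (Im z), exp (Re z) * sin (Im z)).

(* x ^ s for x > 0, principal branch *)
Definition Rpow_C (x : R) (s : C) : C := Cexp (s * RtoC (ln x))%C.

(* f is the sum of a convergent complex power series on some disc around s0 *)
Definition analytic_at (f : C -> C) (s0 : C) : Prop :=
  exists (a : nat -> C) (r : R), 0 < r /\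
    forall s : C, Cmod (s - s0)%C < r ->
      @is_pseries C_AbsRing C_NormedModule a (s - s0)%C (f s).

(* zeta is the analytic continuation to C \ {1} of the Dirichlet series
   \sum_(n >= 1) n ^ (- s), Re s > 1. Since C \ {1} is connected, this determines
   zeta off s = 1; the value at the pole, which Rocq's total functions force to
   exist, is left unconstrained. *)
Definition is_riemann_zeta (zeta : C -> C) : Prop :=
  (forall s : C, s <> RtoC 1 -> analytic_at zeta s) /\
  (forall s : C, 1 < Re s ->
     @is_series C_AbsRing C_NormedModule
       (fun n : nat => Rpow_C (INR (S n)) (- s)%C) (zeta s)).

(* lim (1 + 1/2 + ... + 1/n - ln n) *)
Definition euler_gamma : R :=
  real (Lim_seq (fun n : nat => sum_n_m (fun k : nat => / INR k) 1 n - ln (INR n))).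

(* Main.v *)
Require Import Defs.
From Stdlib Require Import Reals Lra Lia Factorial.
From Coquelicot Require Import Coquelicot.

Open Scope R_scope.

(** On the critical line write [a = ln x]. Since [cos (a v) / cosh (pi v)] has integral
    [1 / (2 cosh (a / 2))] over the half-line, the term [x ^ (- s)] contributes [- (x - 1) / (2 (x + 1) ^ 2)] to the
    integral, and [x ^ (1 - s) / (1 - s)] contributes a primitive of this function of [x]. For
    [0 < Re s], [zeta s] is the limit of [sum_(n <= N) n ^ (- s) - N ^ (1 - s) / (1 - s)], with an
    error on the critical line that is at most a multiple of [(1 + |v|) N ^ (- 1/4)]. Integrating
    these approximations gives a limit made of harmonic numbers minus logarithms, which produces
    [gamma], and of partial sums of [1 / n ^ 2].

    The approximation of [zeta] holds for [1 < Re s] by the Dirichlet series. It extends to the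
    critical line because, on each horizontal line [Im s = v <> 0], both sides have imaginary
    parts that are real-analytic in [Re s]. *)

(** * Improper integrals with exponential domination *)

(** Everything is reduced to real calculus in one variable. On the critical line neither half of the
    approximation converges: the sum of the [- (n - 1) / (2 (n + 1) ^ 2)] and the integral attached
    to [N ^ (1 - s) / (1 - s)] both behave like [- ln N / 2], so only their difference has a limit.
    Splitting [(n - 1) / (n + 1) ^ 2] as [1 / (n + 1) - 2 / (n + 1) ^ 2] separates the part giving
    [gamma] from the part giving [pi ^ 2 / 6].

    The weight [1 / cosh (pi v)] makes the scheme work: the error of the approximation, multiplied
    by [v], grows at most quadratically, and an exponential bound absorbs this growth and lets every
    limit pass through the integral. The horizontal line [v = 0] runs into the pole and is excluded
    from the continuation argument; the factor [v] of the integrand makes this harmless.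

    The cosine transform of [1 / cosh] comes without residues, from Fourier analysis on [[0, 1/2]].
    The sine transform is its derivative in [a], and the integral of the main term is then recovered
    from its own derivative in [a], the constant being fixed by letting [a] tend to minus
    infinity. *)

Definition is_RInt_0_infty (f : R -> R) (l : R) : Prop :=
  is_RInt_gen f (at_point 0) (Rbar_locally p_infty) l.

Lemma is_RInt_0_infty_of_lim (f F : R -> R) (l : R) :
  (forall b, 0 <= b -> is_RInt f 0 b (F b)) -> is_lim F p_infty l ->
  is_RInt_0_infty f l.
Proof.
  intros HF Hl P HP.
  apply (Filter_prod _ _ _ (fun x => x = 0) (fun b => 0 < b /\ P (F b))).
  - reflexivity.
  - apply filter_and.
    + exists 0; tauto.
    + apply Hl; exact HP.
  - intros x b -> [Hb HPb]; exists (F b); simpl; split; [apply HF; lra | exact HPb].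
Qed.

Lemma is_RInt_0_infty_ext (f g : R -> R) (l : R) :
  (forall v, 0 < v -> f v = g v) -> is_RInt_0_infty f l -> is_RInt_0_infty g l.
Proof.
  intros Hfg; apply is_RInt_gen_ext.
  apply (Filter_prod _ _ _ (fun x => x = 0) (fun b => 0 < b)).
  - reflexivity.
  - exists 0; tauto.
  - intros x b -> Hb v; simpl; rewrite Rmin_left by lra; intros [Hv _]; auto.
Qed.

Lemma is_RInt_0_infty_plus (f g : R -> R) (lf lg : R) :
  is_RInt_0_infty f lf -> is_RInt_0_infty g lg ->
  is_RInt_0_infty (fun v => f v + g v) (lf + lg).
Proof. exact (is_RInt_gen_plus f g lf lg). Qed.

Lemma is_RInt_0_infty_minus (f g : R -> R) (lf lg : R) :
  is_RInt_0_infty f lf -> is_RInt_0_infty g lg ->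
  is_RInt_0_infty (fun v => f v - g v) (lf - lg).
Proof. exact (is_RInt_gen_minus f g lf lg). Qed.

Lemma is_RInt_0_infty_scal (k : R) (f : R -> R) (l : R) :
  is_RInt_0_infty f l -> is_RInt_0_infty (fun v => k * f v) (k * l).
Proof. exact (is_RInt_gen_scal f k l). Qed.

Lemma is_RInt_0_infty_sum (f : nat -> R -> R) (l : nat -> R) (n : nat) :
  (forall k, is_RInt_0_infty (f k) (l k)) ->
  is_RInt_0_infty (fun v => sum_n (fun k => f k v) n) (sum_n l n).
Proof.
  intros H; induction n as [|n IH].
  - apply is_RInt_0_infty_ext with (f 0%nat).
    + intros v _; now rewrite sum_O.
    + rewrite sum_O; apply H.
  - apply is_RInt_0_infty_ext with (fun v => sum_n (fun k => f k v) n + f (S n) v).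
    + intros v _; now rewrite sum_Sn.
    + rewrite sum_Sn; now apply is_RInt_0_infty_plus.
Qed.

Lemma is_RInt_0_infty_FTC (F f : R -> R) (L : R) :
  (forall v, 0 <= v -> is_derive F v (f v)) ->
  (forall v, 0 <= v -> continuous f v) ->
  is_lim F p_infty L -> is_RInt_0_infty f (L - F 0).
Proof.
  intros HF Hf HL.
  apply is_RInt_0_infty_of_lim with (F := fun b => F b - F 0).
  - intros b Hb; apply (is_RInt_derive F f 0 b); rewrite Rmin_left, Rmax_right by lra;
      intros x Hx; [apply HF|apply Hf]; lra.
  - apply (is_lim_minus' F (fun _ => F 0)); [exact HL|apply is_lim_const].
Qed.

Lemma is_lim_exp_neg (m : R) : 0 < m -> is_lim (fun v => exp (- m * v)) p_infty 0.
Proof.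
  intros Hm; apply (is_lim_comp exp (fun v => - m * v) p_infty 0 m_infty).
  - apply is_lim_exp_m.
  - evar_last.
    + apply is_lim_scal_l, is_lim_id.
    + simpl; destruct (Rle_dec 0 (- m)) as [H|H]; [exfalso; lra|reflexivity].
  - exists 0; easy.
Qed.

Lemma is_RInt_0_infty_exp (C m : R) :
  0 < m -> is_RInt_0_infty (fun v => C * exp (- m * v)) (C / m).
Proof.
  intros Hm.
  replace (C / m) with (0 - - C / m * exp (- m * 0)).
  2: { rewrite Rmult_0_r, exp_0; field; lra. }
  apply (is_RInt_0_infty_FTC (fun v => - C / m * exp (- m * v))).
  - intros v _; auto_derive; [trivial|field; lra].
  - intros v _; apply (ex_derive_continuous (fun v => C * exp (- m * v))); now auto_derive.
  - replace (Finite 0) with (Rbar_mult (- C / m) 0) by (simpl; f_equal; ring).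
    apply is_lim_scal_l, is_lim_exp_neg, Hm.
Qed.

Lemma is_RInt_0_infty_abs_le (f : R -> R) (C m l : R) :
  0 < m -> (forall v, 0 <= v -> Rabs (f v) <= C * exp (- m * v)) ->
  is_RInt_0_infty f l -> Rabs l <= C / m.
Proof.
  intros Hm Hf Hl.
  apply (@RInt_gen_norm R_CompleteNormedModule (at_point 0) (Rbar_locally p_infty) _ _
           f (fun v => C * exp (- m * v)) l (C / m)).
  - apply (Filter_prod _ _ _ (fun x => x = 0) (fun b => 0 < b)).
    + reflexivity.
    + exists 0; tauto.
    + intros x b -> Hb; simpl; lra.
  - apply (Filter_prod _ _ _ (fun x => x = 0) (fun b => 0 < b)).
    + reflexivity.
    + exists 0; tauto.
    + intros x b -> Hb v; simpl; intros [Hv _]; apply Hf, Hv.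
  - exact Hl.
  - apply is_RInt_0_infty_exp, Hm.
Qed.

(** The integral over [[b, c]] is at most [C / m * exp (- m * b)], so the integrals over [[0, b]]
    satisfy the Cauchy criterion as [b] tends to infinity. *)
Lemma ex_RInt_0_infty_dominated (f : R -> R) (C m : R) :
  0 < m -> (forall b, 0 <= b -> ex_RInt f 0 b) ->
  (forall v, 0 <= v -> Rabs (f v) <= C * exp (- m * v)) ->
  exists l, is_RInt_0_infty f l.
Proof.
  intros Hm Hex Hf.
  assert (HC : forall b, 0 <= b -> is_RInt f 0 b (RInt f 0 b)).
  { intros b Hb; apply (@RInt_correct R_CompleteNormedModule), Hex, Hb. }
  pose proof (is_lim_scal_l _ (C / m) _ _ (is_lim_exp_neg m Hm)) as HE.
  simpl in HE; rewrite Rmult_0_r in HE.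
  assert (Hdiff : forall b c, 0 <= b <= c ->
            Rabs (RInt f 0 c - RInt f 0 b) <= C / m * exp (- m * b)).
  { intros b c Hbc.
    assert (Hbi : is_RInt f b c (RInt f 0 c - RInt f 0 b)).
    { replace (RInt f 0 c - RInt f 0 b) with (plus (opp (RInt f 0 b)) (RInt f 0 c)).
      2: { unfold plus, opp; simpl; ring. }
      apply (@is_RInt_Chasles R_NormedModule) with 0.
      - apply (@is_RInt_swap R_NormedModule), HC; lra.
      - apply HC; lra. }
    apply Rle_trans with (C / m * exp (- m * b) - C / m * exp (- m * c)).
    - apply (@norm_RInt_le R_NormedModule f (fun v => C * exp (- m * v)) b c); [lra| |exact Hbi|].
      + intros x Hx; apply Hf; lra.
      + replace (C / m * exp (- m * b) - C / m * exp (- m * c))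
          with (minus (- C / m * exp (- m * c)) (- C / m * exp (- m * b))).
        2: { unfold minus, plus, opp; simpl; field; lra. }
        apply (is_RInt_derive (fun v => - C / m * exp (- m * v))).
        * intros v _; auto_derive; [trivial|field; lra].
        * intros v _; apply (ex_derive_continuous (fun v => C * exp (- m * v))); now auto_derive.
    - assert (0 <= C).
      { specialize (Hf 0 (Rle_refl 0)); rewrite Rmult_0_r, exp_0 in Hf.
        pose proof (Rabs_pos (f 0)); lra. }
      pose proof (exp_pos (- m * c)).
      assert (0 <= C / m) by (apply Rdiv_le_0_compat; lra).
      nra. }
  destruct (proj1 (filterlim_locally_cauchy (F := Rbar_locally p_infty)
              (fun b => RInt f 0 b))) as [l Hl].
  - intros eps.
    apply is_lim_spec in HE; destruct (HE (pos_div_2 eps)) as [M HM]; simpl in HM.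
    exists (fun b => Rmax 0 (Rmax 0 M + 1) < b); split.
    { exists (Rmax 0 (Rmax 0 M + 1)); tauto. }
    set (b0 := Rmax 0 M + 1).
    assert (Hb0 : 0 <= b0 /\ M < b0)
      by (unfold b0; pose proof (Rmax_l 0 M); pose proof (Rmax_r 0 M); lra).
    intros u v Hu Hv; fold b0 in Hu, Hv; rewrite Rmax_right in Hu, Hv by lra.
    specialize (HM b0 (proj2 Hb0)); rewrite Rminus_0_r in HM.
    pose proof (Rle_abs (C / m * exp (- m * b0))) as Ha.
    pose proof (Hdiff b0 u ltac:(lra)) as H1; pose proof (Hdiff b0 v ltac:(lra)) as H2.
    change (Rabs (RInt f 0 v - RInt f 0 u) < eps).
    replace (RInt f 0 v - RInt f 0 u)
      with ((RInt f 0 v - RInt f 0 b0) - (RInt f 0 u - RInt f 0 b0)) by ring.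
    pose proof (Rabs_triang (RInt f 0 v - RInt f 0 b0) (- (RInt f 0 u - RInt f 0 b0))) as H3.
    rewrite Rabs_Ropp in H3; unfold Rminus in *; lra.
  - exists l; now apply is_RInt_0_infty_of_lim with (F := fun b => RInt f 0 b).
Qed.

(* Taylor's formula to order one bounds the difference quotient minus [g a v] by a
   multiple of [h exp (- m v)]. *)
Lemma is_derive_RInt_0_infty (f g : R -> R -> R) (F : R -> R) (g2 : R -> R -> R) (G a C m : R) :
  0 < m ->
  (forall x v, is_derive (fun x => f x v) x (g x v)) ->
  (forall x v, is_derive (fun x => g x v) x (g2 x v)) ->
  (forall x v, Rabs (x - a) <= 1 -> 0 <= v -> Rabs (g2 x v) <= C * exp (- m * v)) ->
  (forall x, is_RInt_0_infty (f x) (F x)) ->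
  is_RInt_0_infty (g a) G ->
  is_derive F a G.
Proof.
  intros Hm Hf Hg Hg2 HF HG.
  assert (Hmain : forall h, Rabs h <= 1 -> Rabs (F (a + h) - F a - h * G) <= h ^ 2 * C / m).
  { intros h Hh.
    apply is_RInt_0_infty_abs_le with (fun v => f (a + h) v - f a v - h * g a v); [exact Hm| |].
    - intros v Hv.
      destruct (MVT_gen (fun x => f x v - (x - a) * g a v) a (a + h) (fun x => g x v - g a v))
        as [c [Hc Ec]].
      { intros x _; evar_last.
        - apply (is_derive_minus (fun x => f x v)); [apply Hf|].
          auto_derive; [trivial|reflexivity].
        - unfold minus, plus, opp; simpl; ring. }
      { intros x _; apply derivable_continuous_pt, ex_derive_Reals_0.
        apply (ex_derive_minus (fun x => f x v)); [eexists; apply Hf|now auto_derive]. }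
      replace (f (a + h) v - f a v - h * g a v) with ((g c v - g a v) * h) by lra.
      destruct (MVT_gen (fun x => g x v) a c (fun x => g2 x v)) as [d [Hd Ed]].
      { intros x _; apply Hg. }
      { intros x _; apply derivable_continuous_pt, ex_derive_Reals_0; eexists; apply Hg. }
      rewrite Ed, !Rabs_mult.
      assert (Hca : Rabs (c - a) <= Rabs h).
      { revert Hc; unfold Rmin, Rmax, Rabs; repeat destruct Rle_dec; repeat destruct Rcase_abs; lra. }
      assert (Hda : Rabs (d - a) <= 1).
      { revert Hd Hca Hh; unfold Rmin, Rmax, Rabs; repeat destruct Rle_dec; repeat destruct Rcase_abs; lra. }
      pose proof (Hg2 d v Hda Hv) as H2.
      pose proof (Rabs_pos h); pose proof (Rabs_pos (c - a)); pose proof (Rabs_pos (g2 d v)).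
      rewrite <- (pow2_abs h).
      apply Rle_trans with (C * exp (- m * v) * Rabs h * Rabs h); [|simpl; lra].
      apply Rmult_le_compat_r; [lra|].
      apply Rmult_le_compat; lra.
    - apply is_RInt_0_infty_minus; [apply is_RInt_0_infty_minus; apply HF|].
      apply is_RInt_0_infty_scal, HG. }
  apply is_derive_Reals; intros eps Heps.
  set (B := Rabs (C / m) + 1).
  assert (HB : 0 < B) by (unfold B; pose proof (Rabs_pos (C / m)); lra).
  assert (Hd : 0 < Rmin 1 (eps / B)).
  { apply Rmin_pos; [lra|apply Rdiv_lt_0_compat; lra]. }
  exists (mkposreal _ Hd); intros h Hh0 Hh; simpl in Hh.
  assert (Hh1 : Rabs h <= 1) by (pose proof (Rmin_l 1 (eps / B)); lra).
  assert (Hh2 : Rabs h < eps / B) by (pose proof (Rmin_r 1 (eps / B)); lra).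
  replace ((F (a + h) - F a) / h - G) with ((F (a + h) - F a - h * G) / h) by (field; exact Hh0).
  assert (Hhp : 0 < Rabs h) by now apply Rabs_pos_lt.
  unfold Rdiv at 1; rewrite Rabs_mult, Rabs_inv.
  apply Rle_lt_trans with (h ^ 2 * C / m * / Rabs h).
  { apply Rmult_le_compat_r; [left; now apply Rinv_0_lt_compat|now apply Hmain]. }
  rewrite <- (pow2_abs h).
  replace (Rabs h ^ 2 * C / m * / Rabs h) with (Rabs h * (C / m)) by (field; lra).
  apply Rle_lt_trans with (Rabs h * B).
  - apply Rmult_le_compat_l; [lra|unfold B; pose proof (Rle_abs (C / m)); lra].
  - apply Rlt_div_r in Hh2; lra.
Qed.

(** * The Fourier transform of the hyperbolic secant *)

Lemma PI_gt_3 : 3 < PI.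
Proof. pose proof PI2_3_2; lra. Qed.

Lemma exp_le (x y : R) : x <= y -> exp x <= exp y.
Proof. intros [H|H]; [left; now apply exp_increasing|rewrite H; apply Rle_refl]. Qed.

Lemma cosh_pos (x : R) : 0 < cosh x.
Proof. unfold cosh; pose proof (exp_pos x); pose proof (exp_pos (- x)); lra. Qed.

Lemma cosh_ge_1 (x : R) : 1 <= cosh x.
Proof.
  unfold cosh; pose proof (exp_pos x); pose proof (exp_pos (- x)).
  assert (E : exp x * exp (- x) = 1) by (rewrite <- exp_plus, Rplus_opp_r; apply exp_0).
  pose proof (pow2_ge_0 (exp x - 1)); nra.
Qed.

(** Since [PI > 3], [cosh (PI * v)] is at least [exp (3 * v) / 2], while
    [(1 + v) ^ 2 <= exp (2 * v)]; a factor [exp (- v)] remains. Quadratic growth is the most that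
    occurs below. *)
Lemma sqr_div_cosh_le (v : R) : 0 <= v -> (1 + v) ^ 2 / cosh (PI * v) <= 2 * exp (- (1) * v).
Proof.
  intros Hv.
  apply Rle_div_l; [apply Rlt_gt, cosh_pos|].
  assert (H1 : exp (3 * v) / 2 <= cosh (PI * v)).
  { unfold cosh; pose proof (exp_pos (- (PI * v))).
    assert (exp (3 * v) <= exp (PI * v)) by (apply exp_le; pose proof PI_gt_3; nra).
    lra. }
  assert (H2 : (1 + v) ^ 2 <= exp (2 * v)).
  { replace (2 * v) with (v + v) by ring; rewrite exp_plus.
    pose proof (exp_ineq1_le v); simpl; nra. }
  apply Rle_trans with (2 * exp (- (1) * v) * (exp (3 * v) / 2)).
  - replace (2 * exp (- (1) * v) * (exp (3 * v) / 2)) with (exp (- (1) * v) * exp (3 * v)) by field.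
    rewrite <- exp_plus; replace (- (1) * v + 3 * v) with (2 * v) by ring; exact H2.
  - apply Rmult_le_compat_l; [pose proof (exp_pos (- (1) * v)); lra|exact H1].
Qed.

Lemma abs_div_cosh_le (C x v : R) :
  0 <= v -> Rabs x <= C * (1 + v) ^ 2 -> Rabs (x / cosh (PI * v)) <= C * 2 * exp (- (1) * v).
Proof.
  intros Hv Hx; pose proof (cosh_pos (PI * v)) as Hc.
  unfold Rdiv; rewrite Rabs_mult, Rabs_inv, (Rabs_pos_eq (cosh _)) by lra.
  apply Rle_trans with (C * ((1 + v) ^ 2 / cosh (PI * v))).
  - unfold Rdiv; rewrite <- Rmult_assoc.
    apply Rmult_le_compat_r; [left; now apply Rinv_0_lt_compat|exact Hx].
  - rewrite Rmult_assoc; apply Rmult_le_compat_l; [|now apply sqr_div_cosh_le].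
    pose proof (Rabs_pos x); assert (0 < (1 + v) ^ 2) by (apply pow_lt; lra); nra.
Qed.

Lemma continuous_div_cosh (f : R -> R) (v : R) :
  continuous f v -> continuous (fun v => f v / cosh (PI * v)) v.
Proof.
  intros Hf; apply (continuous_mult f (fun v => / cosh (PI * v))); [exact Hf|].
  apply (ex_derive_continuous (fun v => / cosh (PI * v))).
  unfold cosh; auto_derive.
  pose proof (cosh_pos (PI * v)) as H; unfold cosh in H.
  intros E; rewrite Rmult_comm in E; unfold Rdiv in H; lra.
Qed.

Lemma ex_RInt_div_cosh (C : R) (f : R -> R) :
  (forall v, 0 <= v -> continuous f v) -> (forall v, 0 <= v -> Rabs (f v) <= C * (1 + v) ^ 2) ->
  exists l, is_RInt_0_infty (fun v => f v / cosh (PI * v)) l.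
Proof.
  intros Hc Hf; apply (ex_RInt_0_infty_dominated _ (C * 2) 1); [lra| |].
  - intros b Hb; apply (@ex_RInt_continuous R_CompleteNormedModule).
    intros v Hv; rewrite Rmin_left in Hv by lra; apply continuous_div_cosh, Hc; lra.
  - intros v Hv; apply abs_div_cosh_le; auto.
Qed.

Lemma Rabs_cos_le_1 (x : R) : Rabs (cos x) <= 1.
Proof. apply Rabs_le; pose proof (COS_bound x); lra. Qed.

Lemma Rabs_sin_le_1 (x : R) : Rabs (sin x) <= 1.
Proof. apply Rabs_le; pose proof (SIN_bound x); lra. Qed.

Lemma is_lim_squeeze_0 (f g : R -> R) :
  (forall v, 0 <= v -> Rabs (f v) <= g v) -> is_lim g p_infty 0 -> is_lim f p_infty 0.
Proof.
  intros Hfg Hg; apply is_lim_le_le_loc with (fun v => - g v) g.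
  - exists 0; intros v Hv; specialize (Hfg v ltac:(lra)); apply Rabs_le_between in Hfg; lra.
  - replace (Finite 0) with (Rbar_opp 0) by (simpl; f_equal; ring).
    now apply is_lim_opp.
  - exact Hg.
Qed.

Lemma is_RInt_0_infty_cos_exp (a c : R) :
  0 < c -> is_RInt_0_infty (fun v => cos (a * v) * exp (- c * v)) (c / (a ^ 2 + c ^ 2)).
Proof.
  intros Hc.
  assert (Hac : 0 < a ^ 2 + c ^ 2) by nra.
  set (F := fun v => (a * sin (a * v) - c * cos (a * v)) / (a ^ 2 + c ^ 2) * exp (- c * v)).
  replace (c / (a ^ 2 + c ^ 2)) with (0 - F 0).
  2: { unfold F; rewrite !Rmult_0_r, sin_0, cos_0, exp_0; field; lra. }
  apply is_RInt_0_infty_FTC.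
  - intros v _; unfold F; auto_derive; [trivial|field; lra].
  - intros v _; apply (ex_derive_continuous (fun v => cos (a * v) * exp (- c * v))); now auto_derive.
  - apply is_lim_squeeze_0 with (fun v => (Rabs a + c) / (a ^ 2 + c ^ 2) * exp (- c * v)).
    + intros v _; unfold F.
      rewrite Rabs_mult, (Rabs_pos_eq (exp _)) by (left; apply exp_pos).
      apply Rmult_le_compat_r; [left; apply exp_pos|].
      unfold Rdiv; rewrite Rabs_mult, Rabs_inv, (Rabs_pos_eq (a ^ 2 + c ^ 2)) by lra.
      apply Rmult_le_compat_r; [left; now apply Rinv_0_lt_compat|].
      pose proof (Rabs_triang (a * sin (a * v)) (- (c * cos (a * v)))) as H.
      rewrite Rabs_Ropp, !Rabs_mult, (Rabs_pos_eq c) in H by lra.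
      pose proof (Rabs_sin_le_1 (a * v)); pose proof (Rabs_cos_le_1 (a * v)).
      pose proof (Rabs_pos a); unfold Rminus; nra.
    + replace (Finite 0) with (Rbar_mult ((Rabs a + c) / (a ^ 2 + c ^ 2)) 0)
        by (simpl; f_equal; ring).
      apply is_lim_scal_l, is_lim_exp_neg, Hc.
Qed.

Lemma sum_n_Rmult_l (c : R) (f : nat -> R) (n : nat) :
  sum_n (fun k => c * f k) n = c * sum_n f n.
Proof. exact (@sum_n_mult_l R_Ring c f n). Qed.

Lemma sum_n_Rext (f g : nat -> R) (n : nat) :
  (forall k, f k = g k) -> sum_n f n = sum_n g n.
Proof. exact (sum_n_ext f g n). Qed.

(** These numbers play two roles: they are the decay rates in [1 / cosh (pi v) = 2 sum (-1)^k exp (-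
    (2k+1) pi v)], and the frequencies whose cosines vanish at [1/2]. The coincidence turns the
    transform into a question about Fourier coefficients. *)
Definition odd_pi (k : nat) : R := (2 * INR k + 1) * PI.

Lemma odd_pi_pos (k : nat) : 0 < odd_pi k.
Proof. unfold odd_pi; pose proof (pos_INR k); pose proof PI_RGT_0; nra. Qed.

(** Multiplication by [2 cosh (pi v)] turns each exponential into the sum of its two neighbours at
    even multiples of [pi], and the alternating signs make the sum telescope. *)
Lemma cosh_mul_geometric (v : R) (K : nat) :
  cosh (PI * v) * (2 * sum_n (fun k => (-1) ^ k * exp (- odd_pi k * v)) K)
  = 1 - (-1) ^ S K * exp (- (2 * INR (S K) * PI) * v).
Proof.
  assert (Hk : forall k, cosh (PI * v) * (2 * exp (- odd_pi k * v))
             = exp (- (2 * INR k * PI) * v) + exp (- (2 * INR (S k) * PI) * v)).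
  { intros k; unfold cosh.
    replace (- (2 * INR k * PI) * v) with (PI * v + - odd_pi k * v)
      by (unfold odd_pi; ring).
    replace (- (2 * INR (S k) * PI) * v) with (- (PI * v) + - odd_pi k * v)
      by (unfold odd_pi; rewrite S_INR; ring).
    rewrite !exp_plus; field. }
  induction K as [|K IH].
  - rewrite sum_O; specialize (Hk 0%nat).
    change (INR 0) with 0 in Hk; rewrite Rmult_0_r, Rmult_0_l, Ropp_0, Rmult_0_l, exp_0 in Hk.
    rewrite pow_O, pow_1; lra.
  - rewrite sum_Sn; unfold plus; simpl plus; specialize (Hk (S K)).
    rewrite (Rmult_plus_distr_l 2), Rmult_plus_distr_l, IH.
    replace (cosh (PI * v) * (2 * ((-1) ^ S K * exp (- odd_pi (S K) * v))))
      with ((-1) ^ S K * (cosh (PI * v) * (2 * exp (- odd_pi (S K) * v)))) by ring.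
    rewrite Hk; simpl pow; ring.
Qed.

Definition sech_partial (a : R) (K : nat) : R :=
  sum_n (fun k => (-1) ^ k * (odd_pi k / (a ^ 2 + odd_pi k ^ 2))) K.

(** The truncated geometric series misses [1 / cosh (pi v)] by at most [exp (- 2 (K + 1) pi v)]. The
    weaker rate [K + 1] is enough, and its integral is the bound. *)
Lemma sech_transform_approx (a l : R) (K : nat) :
  is_RInt_0_infty (fun v => cos (a * v) / cosh (PI * v)) l ->
  Rabs (l - 2 * sech_partial a K) <= / INR (S K).
Proof.
  intros Hl.
  assert (HS : 0 < INR (S K)) by (apply lt_0_INR; lia).
  rewrite <- (Rmult_1_l (/ INR (S K))).
  apply is_RInt_0_infty_abs_le with (fun v => cos (a * v) / cosh (PI * v) - 2 *
     sum_n (fun k => (-1) ^ k * (cos (a * v) * exp (- odd_pi k * v))) K); [exact HS| |].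
  - intros v Hv; pose proof (cosh_pos (PI * v)) as Hc; pose proof (cosh_ge_1 (PI * v)) as Hc1.
    rewrite (sum_n_Rext _ (fun k => (cos (a * v)) * ((-1) ^ k * exp (- odd_pi k * v)))).
    2: { intros k; ring. }
    rewrite sum_n_Rmult_l.
    pose proof (cosh_mul_geometric v K) as HG.
    set (s := sum_n _ K) in *.
    replace (cos (a * v) / cosh (PI * v) - 2 * (cos (a * v) * s))
      with (cos (a * v) / cosh (PI * v) * (1 - cosh (PI * v) * (2 * s))) by (field; lra).
    rewrite HG.
    replace (1 - (1 - (-1) ^ S K * exp (- (2 * INR (S K) * PI) * v)))
      with ((-1) ^ S K * exp (- (2 * INR (S K) * PI) * v)) by ring.
    unfold Rdiv; rewrite !Rabs_mult, Rabs_inv, pow_1_abs, (Rabs_pos_eq (cosh _)),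
      (Rabs_pos_eq (exp _)) by (try apply Rlt_le, exp_pos; lra).
    pose proof (Rabs_cos_le_1 (a * v)) as H1; pose proof (Rabs_pos (cos (a * v))) as H2.
    assert (H3 : / cosh (PI * v) <= 1) by (rewrite <- Rinv_1; apply Rinv_le_contravar; lra).
    pose proof (Rinv_0_lt_compat _ Hc) as H4.
    assert (H5 : exp (- (2 * INR (S K) * PI) * v) <= exp (- INR (S K) * v)).
    { apply exp_le; pose proof PI_gt_3; pose proof (Rmult_le_pos _ _ (Rlt_le _ _ HS) Hv); nra. }
    rewrite Rmult_1_l; apply Rmult_le_compat; try lra; [|left; apply exp_pos|].
    + apply Rmult_le_pos; lra.
    + rewrite <- (Rmult_1_l 1); apply Rmult_le_compat; lra.
  - apply is_RInt_0_infty_minus; [exact Hl|].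
    apply is_RInt_0_infty_scal.
    apply (is_RInt_0_infty_sum (fun k v => (-1) ^ k * (cos (a * v) * exp (- odd_pi k * v)))).
    intros k; apply is_RInt_0_infty_scal, is_RInt_0_infty_cos_exp, odd_pi_pos.
Qed.

Lemma cos_odd_pi_half (k : nat) : cos (odd_pi k * / 2) = 0 /\ sin (odd_pi k * / 2) = (-1) ^ k.
Proof.
  induction k as [|k [IHc IHs]].
  - replace (odd_pi 0 * / 2) with (PI / 2) by (unfold odd_pi; simpl; field).
    rewrite cos_PI2, sin_PI2; simpl; auto.
  - replace (odd_pi (S k) * / 2) with (odd_pi k * / 2 + PI)
      by (unfold odd_pi; rewrite S_INR; field).
    rewrite neg_cos, neg_sin, IHc, IHs; simpl; lra.
Qed.

(** At [t = 1/2] the cosine vanishes and only the sine term of the primitive survives, so the value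
    splits into [cosh (a / 2)] times the [k]-th term of [sech_partial a]. *)
Lemma is_RInt_cosh_cos (a : R) (k : nat) :
  is_RInt (fun t => cosh (a * t) * cos (odd_pi k * t)) 0 (/ 2)
    (cosh (a / 2) * ((-1) ^ k * (odd_pi k / (a ^ 2 + odd_pi k ^ 2)))).
Proof.
  pose proof (odd_pi_pos k) as Hc; destruct (cos_odd_pi_half k) as [Ec Es].
  set (c := odd_pi k) in *.
  assert (Hac : 0 < a ^ 2 + c ^ 2) by nra.
  set (F := fun t => (a * ((exp (a * t) - exp (- (a * t))) / 2) * cos (c * t)
                     + c * ((exp (a * t) + exp (- (a * t))) / 2) * sin (c * t)) / (a ^ 2 + c ^ 2)).
  replace (cosh (a / 2) * ((-1) ^ k * (c / (a ^ 2 + c ^ 2)))) with (F (/ 2) - F 0).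
  2: { unfold F, cosh; rewrite Ec, Es, !Rmult_0_r, sin_0, Ropp_0.
       unfold Rdiv; field; lra. }
  apply (is_RInt_derive F).
  - intros t _; unfold F, cosh; auto_derive; [trivial|field; lra].
  - intros t _; unfold cosh.
    apply (ex_derive_continuous (fun t => (exp (a * t) + exp (- (a * t))) / 2 * cos (c * t))).
    now auto_derive.
Qed.

Lemma is_RInt_sum_n (f : nat -> R -> R) (l : nat -> R) (a b : R) (n : nat) :
  (forall k, is_RInt (f k) a b (l k)) ->
  is_RInt (fun t => sum_n (fun k => f k t) n) a b (sum_n l n).
Proof.
  intros H; induction n as [|n IH].
  - apply is_RInt_ext with (f 0%nat).
    + intros t _; now rewrite sum_O.
    + rewrite sum_O; apply H.
  - apply is_RInt_ext with (fun t => plus (sum_n (fun k => f k t) n) (f (S n) t)).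
    + intros t _; now rewrite sum_Sn.
    + rewrite sum_Sn; now apply (@is_RInt_plus R_NormedModule).
Qed.

Lemma sin_mul_sum_cos (t : R) (m : nat) :
  2 * sin (PI * t) * sum_n (fun k => cos (odd_pi k * t)) m = sin (2 * INR (S m) * (PI * t)).
Proof.
  assert (H : forall k, 2 * sin (PI * t) * cos (odd_pi k * t)
              = sin (2 * INR (S k) * (PI * t)) - sin (2 * INR k * (PI * t))).
  { intros k.
    replace (2 * INR (S k) * (PI * t)) with (odd_pi k * t + PI * t)
      by (unfold odd_pi; rewrite S_INR; ring).
    replace (2 * INR k * (PI * t)) with (odd_pi k * t - PI * t) by (unfold odd_pi; ring).
    rewrite sin_plus, sin_minus; ring. }
  induction m as [|m IH].
  - rewrite sum_O, H; change (INR 0) with 0; rewrite Rmult_0_r, Rmult_0_l, sin_0; ring.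
  - rewrite sum_Sn; unfold plus; simpl plus; rewrite Rmult_plus_distr_l, IH, H; ring.
Qed.

Lemma sin_mul_sum_sin (x : R) (M : nat) :
  sin x * sum_n (fun m => sin (2 * INR (S m) * x)) M = sin (INR (S M) * x) * sin (INR (S (S M)) * x).
Proof.
  induction M as [|M IH].
  - rewrite sum_O; simpl; rewrite Rmult_1_r, Rmult_1_l; reflexivity.
  - rewrite sum_Sn; unfold plus; simpl plus; rewrite Rmult_plus_distr_l, IH.
    replace (2 * INR (S (S M)) * x) with (2 * (INR (S (S M)) * x)) by ring.
    replace (INR (S (S (S M))) * x) with (INR (S (S M)) * x + x)
      by (rewrite (S_INR (S (S M))); ring).
    replace (INR (S M) * x) with (INR (S (S M)) * x - x) by (rewrite (S_INR (S M)); ring).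
    rewrite sin_2a, sin_plus, sin_minus; ring.
Qed.

(** The inner sums are Dirichlet kernels [sin (2 (m + 1) pi t) / (2 sin (pi t))]; adding them gives
    a product of two sines over [2 sin (pi t) ^ 2], hence a bound independent of [M]. Keeping the
    denominator on the left covers [t = 0]. *)
Lemma fejer_bound (t : R) (M : nat) :
  2 * sin (PI * t) ^ 2 * Rabs (sum_n (fun m => sum_n (fun k => cos (odd_pi k * t)) m) M) <= 1.
Proof.
  set (s := sum_n _ M).
  assert (E : 2 * sin (PI * t) ^ 2 * s = sin (INR (S M) * (PI * t)) * sin (INR (S (S M)) * (PI * t))).
  { rewrite <- sin_mul_sum_sin.
    rewrite (sum_n_Rext _ (fun m => 2 * sin (PI * t) * (sum_n (fun k => cos (odd_pi k * t)) m))).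
    2: { intros m; symmetry; apply sin_mul_sum_cos. }
    rewrite sum_n_Rmult_l.
    change (2 * sin (PI * t) ^ 2 * s = sin (PI * t) * (2 * sin (PI * t) * s)); ring. }
  rewrite <- (Rabs_pos_eq (2 * sin (PI * t) ^ 2)) by (pose proof (pow2_ge_0 (sin (PI * t))); lra).
  rewrite <- Rabs_mult, E, Rabs_mult, <- (Rmult_1_l 1).
  apply Rmult_le_compat; try apply Rabs_pos; apply Rabs_sin_le_1.
Qed.

(** From [sin y >= y cos y] at [y = x / 2]: [sin x = 2 sin y cos y >= x cos (x / 2) ^ 2 = x (1 + cos
    x) / 2 >= x / 2]. *)
Lemma half_le_sin (x : R) : 0 <= x <= PI / 2 -> x / 2 <= sin x.
Proof.
  intros Hx.
  assert (H1 : x / 2 * cos (x / 2) <= sin (x / 2)).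
  { destruct (MVT_gen (fun y => sin y - y * cos y) 0 (x / 2) (fun y => y * sin y)) as [c [Hc E]].
    - intros y _; auto_derive; [trivial|ring].
    - intros y _; apply derivable_continuous_pt, ex_derive_Reals_0; now auto_derive.
    - rewrite Rmin_left, Rmax_right in Hc by lra.
      rewrite sin_0, Rmult_0_l in E.
      assert (0 <= sin c) by (apply sin_ge_0; pose proof PI_RGT_0; lra).
      assert (0 <= c * sin c * (x / 2 - 0)) by (repeat apply Rmult_le_pos; lra).
      lra. }
  replace x with (2 * (x / 2)) at 2 by field; rewrite sin_2a.
  assert (H2 : 0 <= cos (x / 2)) by (apply cos_ge_0; pose proof PI_RGT_0; lra).
  assert (H3 : cos x = 2 * cos (x / 2) * cos (x / 2) - 1)
    by (rewrite <- cos_2a_cos; f_equal; field).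
  assert (H4 : 0 <= cos x) by (apply cos_ge_0; lra).
  nra.
Qed.

(** The quadratic vanishing at [t = 0] is what compensates the factor [1 / sin (pi t) ^ 2] in the
    bound on Fejer's kernel. It comes from two applications of the mean value theorem. *)
Lemma cosh_minus_1_le (a t : R) : 0 <= t <= 1 -> cosh (a * t) - 1 <= a ^ 2 * exp (Rabs a) * t ^ 2.
Proof.
  intros Ht.
  assert (Hcosh : forall y, Rabs y <= Rabs a -> Rabs (cosh y) <= exp (Rabs a)).
  { intros y Hy; rewrite Rabs_pos_eq by (left; apply cosh_pos); unfold cosh.
    apply Rabs_le_between in Hy.
    assert (exp y <= exp (Rabs a)) by (apply exp_le; lra).
    assert (exp (- y) <= exp (Rabs a)) by (apply exp_le; lra).
    lra. }
  assert (Hmul : forall u, 0 <= u <= t -> Rabs (a * u) <= Rabs a).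
  { intros u Hu; rewrite Rabs_mult, (Rabs_pos_eq u) by lra; pose proof (Rabs_pos a); nra. }
  destruct (MVT_gen (fun u => (exp (a * u) + exp (- (a * u))) / 2) 0 t
              (fun u => a * ((exp (a * u) - exp (- (a * u))) / 2))) as [c [Hc E]].
  { intros y _; auto_derive; [trivial|field]. }
  { intros y _; apply derivable_continuous_pt, ex_derive_Reals_0; now auto_derive. }
  rewrite Rmin_left, Rmax_right in Hc by lra.
  destruct (MVT_gen (fun u => a * ((exp (a * u) - exp (- (a * u))) / 2)) 0 c
              (fun u => a ^ 2 * cosh (a * u))) as [d [Hd E2]].
  { intros y _; unfold cosh; auto_derive; [trivial|field]. }
  { intros y _; apply derivable_continuous_pt, ex_derive_Reals_0; now auto_derive. }
  rewrite Rmin_left, Rmax_right in Hd by lra.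
  rewrite !Rmult_0_r, Ropp_0, exp_0 in E, E2.
  assert (E3 : a * ((exp (a * c) - exp (- (a * c))) / 2) = a ^ 2 * cosh (a * d) * c) by lra.
  rewrite E3 in E.
  unfold cosh at 1.
  pose proof (Hcosh _ (Hmul d ltac:(lra))) as H; pose proof (Rle_abs (cosh (a * d))).
  pose proof (cosh_pos (a * d)).
  replace ((exp (a * t) + exp (- (a * t))) / 2 - 1) with (a ^ 2 * cosh (a * d) * (c * t)) by lra.
  pose proof (pow2_ge_0 a).
  apply Rmult_le_compat; [apply Rmult_le_pos; lra|nra| |nra].
  apply Rmult_le_compat_l; lra.
Qed.

(** The Cesaro means tend to [E], and they also tend to 0 because bounded sums are divided by [n].
    To identify a limit known to exist, uniformly bounded sums therefore suffice. *)
Lemma lim_seq_0_of_bounded_sums (e : nat -> R) (E B : R) :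
  is_lim_seq e E -> (forall M, Rabs (sum_n e M) <= B) -> E = 0.
Proof.
  intros HE HB.
  assert (H1 : is_lim_seq (fun n => sum_f_R0 e (pred n) / INR n) E).
  { apply is_lim_seq_Reals, Cesaro_1, is_lim_seq_Reals, HE. }
  assert (H2 : is_lim_seq (fun n => sum_f_R0 e (pred n) / INR n) 0).
  { apply is_lim_seq_abs_0.
    apply is_lim_seq_le_le with (fun _ => 0) (fun n => B * / INR n).
    - intros n; split; [apply Rabs_pos|].
      unfold Rdiv; rewrite Rabs_mult, Rabs_inv, (Rabs_pos_eq (INR n)) by apply pos_INR.
      apply Rmult_le_compat_r; [|rewrite <- sum_n_Reals; apply HB].
      (* At index 0 the inequality relies on the convention that the inverse of 0 is 0. *)
      destruct n as [|n]; [simpl; rewrite Rinv_0; lra|].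
      left; apply Rinv_0_lt_compat, lt_0_INR; lia.
    - apply is_lim_seq_const.
    - replace (Finite 0) with (Rbar_mult B 0) by (simpl; f_equal; ring).
      apply is_lim_seq_scal_l.
      replace (Finite 0) with (Rbar_inv p_infty) by reflexivity.
      apply is_lim_seq_inv; [apply is_lim_seq_INR|easy]. }
  apply is_lim_seq_unique in H1; apply is_lim_seq_unique in H2; congruence.
Qed.

(** At frequency 0 there is an elementary primitive. This case anchors the general one: comparing
    the frequencies [a] and 0 replaces [cosh (a t)] by [cosh (a t) - 1], which vanishes where
    Fejer's kernel concentrates. *)
Lemma sech_transform_0 : is_RInt_0_infty (fun v => / cosh (PI * v)) (/ 2).
Proof.
  pose proof PI_RGT_0 as HPI.
  set (F := fun v => - (2 / PI) * atan (exp (- PI * v))).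
  replace (/ 2) with (0 - F 0).
  2: { unfold F; rewrite Rmult_0_r, exp_0, atan_1; field; lra. }
  apply is_RInt_0_infty_FTC.
  - intros v _; unfold F, cosh; auto_derive; [trivial|].
    replace (- (PI * v)) with (- PI * v) by ring.
    assert (E : exp (PI * v) = / exp (- PI * v)) by (rewrite <- exp_Ropp; f_equal; ring).
    rewrite E; pose proof (exp_pos (- PI * v)).
    unfold Rsqr; field; repeat split; nra.
  - intros v _; apply continuous_ext with (fun v => 1 / cosh (PI * v)).
    + intros x; apply Rmult_1_l.
    + apply (continuous_div_cosh (fun _ => 1)), continuous_const.
  - replace (Finite 0) with (Rbar_mult (- (2 / PI)) (atan 0)).
    2: { simpl; rewrite atan_0; f_equal; ring. }
    apply is_lim_scal_l.
    apply is_lim_comp_continuous; [apply is_lim_exp_neg, HPI|].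
    apply (ex_derive_continuous atan); now auto_derive.
Qed.

(* The coefficients of [cosh (a t)] on the cosines [cos ((2k+1) pi t)] over [0, 1/2] are the
   terms of the partial fraction expansion of [1 / (2 cosh (a / 2))]; Fejer's kernel shows that
   the expansion converges to the right value. *)
Lemma sech_transform (a : R) :
  is_RInt_0_infty (fun v => cos (a * v) / cosh (PI * v)) (/ (2 * cosh (a / 2))).
Proof.
  assert (Hex : forall a, exists l, is_RInt_0_infty (fun v => cos (a * v) / cosh (PI * v)) l).
  { clear a; intros a; apply (ex_RInt_div_cosh 1).
    - intros v _; apply (ex_derive_continuous (fun v => cos (a * v))); now auto_derive.
    - intros v Hv; pose proof (Rabs_cos_le_1 (a * v)); nra. }
  destruct (Hex a) as [l Hl].
  assert (H0 : is_RInt_0_infty (fun v => cos (0 * v) / cosh (PI * v)) (/ 2)).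
  { apply is_RInt_0_infty_ext with (2 := sech_transform_0).
    intros v _; rewrite Rmult_0_l, cos_0; unfold Rdiv; ring. }
  assert (Hlim : forall a l, is_RInt_0_infty (fun v => cos (a * v) / cosh (PI * v)) l ->
            is_lim_seq (fun K => 2 * sech_partial a K) l).
  { clear; intros a l H.
    apply is_lim_seq_ext with (fun K => l - (l - 2 * sech_partial a K)); [intros; ring|].
    replace (Finite l) with (Rbar_minus l 0) by (simpl; f_equal; ring).
    apply is_lim_seq_minus'; [apply is_lim_seq_const|].
    apply is_lim_seq_abs_0.
    apply is_lim_seq_le_le with (fun _ => 0) (fun K => / INR (S K)).
    - intros K; split; [apply Rabs_pos|now apply sech_transform_approx].
    - apply is_lim_seq_const.
    - apply (is_lim_seq_incr_1 (fun n => / INR n)).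
      replace (Finite 0) with (Rbar_inv p_infty) by reflexivity.
      apply is_lim_seq_inv; [apply is_lim_seq_INR|easy]. }
  (* The limit of [e] is [cosh (a / 2) * l - 1/2], so the claim is that this limit is 0. By
     [is_RInt_cosh_cos], [e K] is an integral of [cosh (a t) - 1] against a Dirichlet kernel. *)
  set (e := fun K => cosh (a / 2) * (2 * sech_partial a K) - 2 * sech_partial 0 K).
  assert (He : is_lim_seq e (cosh (a / 2) * l - / 2)).
  { apply is_lim_seq_minus'; [|now apply Hlim].
    apply (is_lim_seq_scal_l _ (cosh (a / 2)) l); now apply Hlim. }
  assert (Hint : forall K, is_RInt (fun t => 2 * (cosh (a * t) - 1) *
             sum_n (fun k => cos (odd_pi k * t)) K) 0 (/ 2) (e K)).
  { intros K.
    assert (HK : forall b, is_RInt (fun t => cosh (b * t) * sum_n (fun k => cos (odd_pi k * t)) K)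
                    0 (/ 2) (cosh (b / 2) * sech_partial b K)).
    { intros b.
      apply is_RInt_ext with (fun t => sum_n (fun k => cosh (b * t) * cos (odd_pi k * t)) K).
      - intros t _; apply (sum_n_Rmult_l (cosh (b * t)) (fun k => cos (odd_pi k * t))).
      - replace (cosh (b / 2) * sech_partial b K)
          with (sum_n (fun k => cosh (b / 2) * ((-1) ^ k * (odd_pi k / (b ^ 2 + odd_pi k ^ 2)))) K).
        2: { apply (sum_n_Rmult_l (cosh (b / 2))
                      (fun k => (-1) ^ k * (odd_pi k / (b ^ 2 + odd_pi k ^ 2)))). }
        apply is_RInt_sum_n with (f := fun k t => cosh (b * t) * cos (odd_pi k * t)).
        intros k; apply is_RInt_cosh_cos. }
    apply is_RInt_ext with (fun t => scal 2 (minus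
        (cosh (a * t) * sum_n (fun k => cos (odd_pi k * t)) K)
        (cosh (0 * t) * sum_n (fun k => cos (odd_pi k * t)) K))).
    - intros t _; rewrite Rmult_0_l, cosh_0.
      unfold scal, minus, plus, opp; simpl; unfold mult; simpl; ring.
    - replace (e K) with (scal 2 (minus (cosh (a / 2) * sech_partial a K)
                                        (cosh (0 / 2) * sech_partial 0 K))).
      2: { unfold Rdiv at 2; rewrite Rmult_0_l, cosh_0; unfold e.
           unfold scal, minus, plus, opp; simpl; unfold mult; simpl; ring. }
      apply (@is_RInt_scal R_NormedModule), (@is_RInt_minus R_NormedModule); apply HK. }
  (* Summed over [K], the kernel is at most [1 / (2 sin (pi t) ^ 2)], and [sin (pi t) >= t] on
     [[0, 1/2]]; this cancels the [t ^ 2] gained from [cosh (a t) - 1] and leaves a constant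
     integrand bound. *)
  assert (Hsum : forall M, Rabs (sum_n e M) <= (/ 2 - 0) * (a ^ 2 * exp (Rabs a))).
  { intros M.
    pose proof (is_RInt_sum_n _ _ _ _ M Hint) as HM.
    rewrite <- (is_RInt_unique _ _ _ _ HM).
    apply abs_RInt_le_const; [lra|eexists; exact HM|].
    intros t Ht.
    pose proof (fejer_bound t M) as HF.
    rewrite (sum_n_Rmult_l (2 * (cosh (a * t) - 1))
               (fun m => sum_n (fun k => cos (odd_pi k * t)) m) M).
    set (s := sum_n (fun m => sum_n (fun k => cos (odd_pi k * t)) m) M) in *.
    pose proof (cosh_minus_1_le a t ltac:(lra)) as Hc; pose proof (cosh_ge_1 (a * t)) as Hc1.
    rewrite !Rabs_mult, (Rabs_pos_eq 2), (Rabs_pos_eq (cosh _ - 1)) by lra.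
    set (B := a ^ 2 * exp (Rabs a)) in *.
    assert (HB : 0 <= B) by (apply Rmult_le_pos; [apply pow2_ge_0|left; apply exp_pos]).
    assert (Hs : t <= sin (PI * t)).
    { pose proof PI_gt_3; pose proof (half_le_sin (PI * t)); nra. }
    assert (Hs2 : t ^ 2 <= sin (PI * t) ^ 2) by (apply pow_incr; lra).
    pose proof (Rabs_pos s).
    apply Rle_trans with (2 * (B * t ^ 2) * Rabs s).
    - apply Rmult_le_compat_r; lra.
    - apply Rle_trans with (B * (2 * sin (PI * t) ^ 2 * Rabs s)); [|nra].
      replace (2 * (B * t ^ 2) * Rabs s) with (B * (2 * t ^ 2 * Rabs s)) by ring.
      apply Rmult_le_compat_l, Rmult_le_compat_r; lra. }
  pose proof (lim_seq_0_of_bounded_sums e _ _ He Hsum) as E.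
  pose proof (cosh_pos (a / 2)).
  replace (/ (2 * cosh (a / 2))) with l; [exact Hl|].
  field_simplify_eq; lra.
Qed.

(** * Integral of the main term *)

(** Minus the derivative of [sech_transform] in [a]; the second derivative
    [v ^ 2 cos (a v) / cosh (pi v)] provides the domination that allows differentiation under the
    integral. *)
Lemma sine_sech_transform (a : R) :
  is_RInt_0_infty (fun v => v * sin (a * v) / cosh (PI * v)) (sinh (a / 2) / (4 * cosh (a / 2) ^ 2)).
Proof.
  destruct (ex_RInt_div_cosh 1 (fun v => v * sin (a * v))) as [l Hl].
  { intros v _; apply (ex_derive_continuous (fun v => v * sin (a * v))); now auto_derive. }
  { intros v Hv; rewrite Rabs_mult, (Rabs_pos_eq v) by lra.
    pose proof (Rabs_sin_le_1 (a * v)); pose proof (Rabs_pos (sin (a * v))); nra. }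
  replace (sinh (a / 2) / (4 * cosh (a / 2) ^ 2)) with l; [exact Hl|].
  assert (HF : is_derive (fun x => / (2 * cosh (x / 2))) a (-1 * l)).
  { apply (is_derive_RInt_0_infty (fun x v => cos (x * v) / cosh (PI * v))
      (fun x v => -1 * (v * sin (x * v) / cosh (PI * v))) _
      (fun x v => - (v ^ 2 * cos (x * v)) / cosh (PI * v)) _ _ (1 * 2) 1).
    - lra.
    - intros x v; pose proof (cosh_pos (PI * v)).
      auto_derive; [trivial|field; lra].
    - intros x v; pose proof (cosh_pos (PI * v)).
      auto_derive; [trivial|field; lra].
    - intros x v _ Hv; apply abs_div_cosh_le; [exact Hv|].
      rewrite Rabs_Ropp, Rabs_mult, (Rabs_pos_eq (v ^ 2)) by apply pow2_ge_0.
      pose proof (Rabs_cos_le_1 (x * v)); pose proof (Rabs_pos (cos (x * v))); nra.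
    - intros x; apply sech_transform.
    - now apply is_RInt_0_infty_scal. }
  apply is_derive_unique in HF.
  assert (HF2 : is_derive (fun x => / (2 * cosh (x / 2))) a (- (sinh (a / 2) / (4 * cosh (a / 2) ^ 2)))).
  { pose proof (cosh_pos (a / 2)) as Hc; unfold cosh, sinh, Rdiv in *.
    auto_derive; [nra|].
    field; nra. }
  apply is_derive_unique in HF2; rewrite HF2 in HF; lra.
Qed.

(* The imaginary part of [exp (a (1/2 - i v)) / (1/2 - i v)], times [v]. *)
Definition main_integrand (a v : R) : R :=
  exp (a / 2) * ((v * cos (a * v) - sin (a * v) / 2) * v / (/ 4 + v ^ 2)).

Lemma quarter_plus_sqr_pos (v : R) : 0 < / 4 + v ^ 2.
Proof. nra. Qed.

Lemma main_integrand_le (a v : R) :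
  0 <= v -> Rabs (main_integrand a v) <= 2 * exp (a / 2) * (1 + v) ^ 2.
Proof.
  intros Hv; unfold main_integrand.
  pose proof (exp_pos (a / 2)) as He; pose proof (quarter_plus_sqr_pos v) as Hq.
  rewrite Rabs_mult, (Rabs_pos_eq (exp _)) by lra.
  replace (2 * exp (a / 2) * (1 + v) ^ 2) with (exp (a / 2) * (2 * (1 + v) ^ 2)) by ring.
  apply Rmult_le_compat_l; [lra|].
  unfold Rdiv at 1; rewrite Rabs_mult, Rabs_inv, (Rabs_pos_eq (/ 4 + v ^ 2)) by lra.
  apply Rle_div_l; [lra|].
  rewrite Rabs_mult, (Rabs_pos_eq v) by lra.
  pose proof (Rabs_triang (v * cos (a * v)) (- (sin (a * v) / 2))) as H.
  unfold Rdiv in H; rewrite Rabs_Ropp, !Rabs_mult, (Rabs_pos_eq v), (Rabs_pos_eq (/ 2)) in H by lra.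
  pose proof (Rabs_cos_le_1 (a * v)); pose proof (Rabs_sin_le_1 (a * v)).
  assert (Hnum : Rabs (v * cos (a * v) - sin (a * v) / 2) <= v + / 2) by (unfold Rminus, Rdiv; nra).
  apply Rle_trans with ((v + / 2) * v); [now apply Rmult_le_compat_r|].
  assert (1 <= (1 + v) ^ 2) by nra.
  apply Rle_trans with (2 * (/ 4 + v ^ 2)); nra.
Qed.

Lemma continuous_main_integrand (a v : R) : continuous (main_integrand a) v.
Proof.
  apply (ex_derive_continuous (main_integrand a)); unfold main_integrand.
  pose proof (quarter_plus_sqr_pos v); auto_derive; nra.
Qed.

(** Differentiation in [a] multiplies [exp (a (1/2 - i v)) / (1/2 - i v)] by [1/2 - i v]: the
    denominator disappears and the integrand of [sine_sech_transform] is left. *)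
Lemma is_derive_main_integrand (a v : R) :
  is_derive (fun a => main_integrand a v / cosh (PI * v)) a
    (- exp (a / 2) * (v * sin (a * v) / cosh (PI * v))).
Proof.
  unfold main_integrand; pose proof (quarter_plus_sqr_pos v); pose proof (cosh_pos (PI * v)).
  auto_derive; [trivial|].
  unfold Rdiv; field; split; lra.
Qed.

(** Both sides have the same derivative in [a]; with [x = exp a] it is [- (x - 1) / (2 (x + 1) ^ 2)]
    with respect to [x]. The constant 1 is the one for which both sides tend to 0 as [x] tends to
    0. *)
Lemma main_integral (a : R) :
  is_RInt_0_infty (fun v => main_integrand a v / cosh (PI * v))
    (1 - ln (1 + exp a) / 2 - / (1 + exp a)).
Proof.
  set (K := fun a => RInt_gen (fun v => main_integrand a v / cosh (PI * v))
                       (at_point 0) (Rbar_locally p_infty)).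
  assert (HK : forall a : R, is_RInt_0_infty (fun v => main_integrand a v / cosh (PI * v)) (K a)).
  { clear a; intros a; apply (@RInt_gen_correct R_CompleteNormedModule).
    - apply Proper_StrongProper, at_point_filter.
    - apply Proper_StrongProper, Rbar_locally_filter.
    - apply (ex_RInt_div_cosh (2 * exp (a / 2))).
      + intros v _; apply continuous_main_integrand.
      + intros v Hv; now apply main_integrand_le. }
  set (h := fun a => K a - (1 - ln (1 + exp a) / 2 - / (1 + exp a))).
  assert (Hh : forall a : R, is_derive h a 0).
  { clear a; intros a; unfold h.
    pose proof (exp_pos a) as Hea.
    assert (HKa : is_derive K a (- exp (a / 2) * (sinh (a / 2) / (4 * cosh (a / 2) ^ 2)))).
    { apply (is_derive_RInt_0_infty (fun x v => main_integrand x v / cosh (PI * v))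
        (fun x v => - exp (x / 2) * (v * sin (x * v) / cosh (PI * v))) K
        (fun x v => - (exp (x / 2) * (sin (x * v) / 2 + v * cos (x * v)) * v) / cosh (PI * v))
        _ _ (exp ((a + 1) / 2) * 2) 1).
      - lra.
      - intros x v; apply is_derive_main_integrand.
      - intros x v; pose proof (cosh_pos (PI * v)).
        auto_derive; [trivial|unfold Rdiv; field; lra].
      - intros x v Hx Hv; apply abs_div_cosh_le; [exact Hv|].
        rewrite Rabs_Ropp, !Rabs_mult, (Rabs_pos_eq v), (Rabs_pos_eq (exp _))
          by (try apply Rlt_le, exp_pos; lra).
        assert (He : exp (x / 2) <= exp ((a + 1) / 2)).
        { apply exp_le; apply Rabs_le_between in Hx; lra. }
        pose proof (exp_pos (x / 2)).
        pose proof (Rabs_triang (sin (x * v) / 2) (v * cos (x * v))) as H1.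
        unfold Rdiv in H1; rewrite !Rabs_mult, (Rabs_pos_eq v), (Rabs_pos_eq (/ 2)) in H1 by lra.
        pose proof (Rabs_cos_le_1 (x * v)); pose proof (Rabs_sin_le_1 (x * v)).
        rewrite Rmult_assoc; apply Rmult_le_compat; try lra.
        + apply Rmult_le_pos; [apply Rabs_pos|lra].
        + apply Rle_trans with ((/ 2 + v) * v); [|nra].
          apply Rmult_le_compat_r; [lra|unfold Rdiv; nra].
      - exact HK.
      - apply is_RInt_0_infty_scal, sine_sech_transform. }
    evar_last.
    - apply (is_derive_minus K); [exact HKa|].
      auto_derive; [lra|reflexivity].
    - unfold minus, plus, opp; simpl; unfold sinh, cosh.
      set (u := exp (a / 2)).
      assert (Hu : 0 < u) by apply exp_pos.
      assert (E : exp a = u * u) by (unfold u; rewrite <- exp_plus; f_equal; field).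
      rewrite exp_Ropp, E; fold u.
      match goal with |- ?x = ?y => change (@eq R x y) end.
      field; repeat split; nra. }
  assert (Hconst : forall x y : R, h x = h y).
  { intros x y; destruct (MVT_gen h x y (fun _ => 0)) as [c [_ Ec]].
    - intros z _; apply Hh.
    - intros z _; apply derivable_continuous_pt, ex_derive_Reals_0; eexists; apply Hh.
    - lra. }
  (* The difference [h] is constant, so it may be evaluated at [- M]. The factor [exp (a / 2)] in
     [main_integrand_le] makes the integral decay there, and the closed form decays like
     [exp (- M)]. *)
  assert (Hbound : forall M, 0 <= M -> Rabs (h a) <= 6 * exp (- / 2 * M)).
  { intros M HM; rewrite (Hconst a (- M)); unfold h.
    assert (H1 : Rabs (K (- M)) <= 2 * exp (- M / 2) * 2 / 1).
    { apply is_RInt_0_infty_abs_le with (3 := HK (- M)); [lra|].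
      intros v Hv; apply abs_div_cosh_le; [exact Hv|now apply main_integrand_le]. }
    replace (- M / 2) with (- / 2 * M) in H1 by field.
    pose proof (exp_pos (- M)) as He.
    assert (H2 : exp (- M) <= exp (- / 2 * M)) by (apply exp_le; lra).
    assert (H3 : 0 <= ln (1 + exp (- M)) <= exp (- M)).
    { split.
      - rewrite <- ln_1; apply ln_le; lra.
      - rewrite <- (ln_exp (exp (- M))) at 2; apply ln_le; [lra|apply exp_ineq1_le]. }
    assert (H4 : 0 <= 1 - / (1 + exp (- M)) <= exp (- M)).
    { replace (1 - / (1 + exp (- M))) with (exp (- M) / (1 + exp (- M))) by (field; lra).
      split; [apply Rdiv_le_0_compat; lra|].
      apply Rle_div_l; nra. }
    apply Rabs_le_between in H1; apply Rabs_le; lra. }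
  assert (H0 : is_lim (fun _ => h a) p_infty 0).
  { apply is_lim_squeeze_0 with (1 := Hbound).
    replace (Finite 0) with (Rbar_mult 6 0) by (simpl; f_equal; ring).
    apply is_lim_scal_l, is_lim_exp_neg; lra. }
  assert (E : h a = 0).
  { apply is_lim_unique in H0; rewrite Lim_const in H0; congruence. }
  unfold h in E.
  replace (1 - ln (1 + exp a) / 2 - / (1 + exp a)) with (K a) by lra; apply HK.
Qed.

(** * The Basel sum and the Euler-Mascheroni constant *)

(* Coquelicot's algebraic operations leave equations typed in a structure over [R], which
   [ring] and [field] do not recognize. *)
Ltac as_R_eq := match goal with |- ?x = ?y => change (@eq R x y) end.

Lemma sum_n_RS (f : nat -> R) (n : nat) : @eq R (sum_n f (S n)) (sum_n f n + f (S n)).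
Proof. exact (sum_Sn f n). Qed.

Lemma sum_n_m_RS (f : nat -> R) (n m : nat) :
  (n <= S m)%nat -> @eq R (sum_n_m f n (S m)) (sum_n_m f n m + f (S m)).
Proof. exact (sum_n_Sm f n m). Qed.

Definition wallis (n : nat) : R := RInt (fun x => cos x ^ (2 * n)) 0 (PI / 2).
Definition wallis_sqr (n : nat) : R := RInt (fun x => x ^ 2 * cos x ^ (2 * n)) 0 (PI / 2).

Lemma ex_RInt_of_derivable (f : R -> R) (a b : R) : (forall x, ex_derive f x) -> ex_RInt f a b.
Proof.
  intros H; apply (@ex_RInt_continuous R_CompleteNormedModule).
  intros x _; apply (ex_derive_continuous f), H.
Qed.

Lemma is_RInt_wallis (n : nat) : is_RInt (fun x => cos x ^ (2 * n)) 0 (PI / 2) (wallis n).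
Proof.
  apply (@RInt_correct R_CompleteNormedModule), ex_RInt_of_derivable; intros x; now auto_derive.
Qed.

Lemma is_RInt_wallis_sqr (n : nat) :
  is_RInt (fun x => x ^ 2 * cos x ^ (2 * n)) 0 (PI / 2) (wallis_sqr n).
Proof.
  apply (@RInt_correct R_CompleteNormedModule), ex_RInt_of_derivable; intros x; now auto_derive.
Qed.

(** Integration by parts in packaged form: each recurrence below is the integral of an exact
    derivative whose primitive vanishes at both ends. *)
Lemma is_RInt_FTC_vanishing (F f : R -> R) (a b l : R) :
  (forall x, is_derive F x (f x)) -> (forall x, continuous f x) -> F a = 0 -> F b = 0 ->
  is_RInt f a b l -> l = 0.
Proof.
  intros HF Hf Ha Hb Hl.
  assert (H : is_RInt f a b (F b - F a)) by (apply (is_RInt_derive F f); auto).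
  rewrite <- (is_RInt_unique _ _ _ _ Hl), (is_RInt_unique _ _ _ _ H); lra.
Qed.

Lemma wallis_rec (n : nat) : (2 * INR n + 2) * wallis (S n) - (2 * INR n + 1) * wallis n = 0.
Proof.
  apply (is_RInt_FTC_vanishing (fun x => sin x * cos x ^ (2 * n + 1))
    (fun x => (2 * INR n + 2) * cos x ^ (2 * S n) - (2 * INR n + 1) * cos x ^ (2 * n)) 0 (PI / 2)).
  - intros x; auto_derive; [trivial|].
    replace (n + (n + 0) + 1)%nat with (S (2 * n)) by lia.
    replace (2 * S n)%nat with (2 * n + 2)%nat by lia.
    change (Init.Nat.pred (S (2 * n))) with (2 * n)%nat.
    rewrite S_INR, mult_INR, pow_add, <- tech_pow_Rmult; change (INR 2) with 2.
    set (c := cos x ^ (2 * n)).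
    pose proof (sin2_cos2 x) as H; unfold Rsqr in H.
    assert (E : sin x * sin x = 1 - cos x * cos x) by lra.
    simpl pow; ring [E].
  - intros x; apply (ex_derive_continuous (fun x => (2 * INR n + 2) * cos x ^ (2 * S n)
      - (2 * INR n + 1) * cos x ^ (2 * n))); now auto_derive.
  - rewrite sin_0; ring.
  - rewrite cos_PI2, pow_i by lia; ring.
  - apply (@is_RInt_minus R_NormedModule);
      apply (@is_RInt_scal R_NormedModule), is_RInt_wallis.
Qed.

(** The primitive collects the boundary terms of two successive integrations by parts of
    [cos x ^ (2 n + 2)], which integrate the factor 1 to [x] and then [x] to [x ^ 2 / 2]. *)
Lemma wallis_sqr_rec (n : nat) :
  wallis (S n) + 2 * (INR n + 1) ^ 2 * wallis_sqr (S n)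
  - (INR n + 1) * (2 * INR n + 1) * wallis_sqr n = 0.
Proof.
  apply (is_RInt_FTC_vanishing
    (fun x => x * cos x ^ (2 * n + 2) + (INR n + 1) * x ^ 2 * sin x * cos x ^ (2 * n + 1))
    (fun x => cos x ^ (2 * S n) + 2 * (INR n + 1) ^ 2 * (x ^ 2 * cos x ^ (2 * S n))
     - (INR n + 1) * (2 * INR n + 1) * (x ^ 2 * cos x ^ (2 * n))) 0 (PI / 2)).
  - intros x; auto_derive; [trivial|].
    replace (n + (n + 0) + 1)%nat with (S (2 * n)) by lia.
    replace (n + (n + 0) + 2)%nat with (S (S (2 * n))) by lia.
    replace (2 * S n)%nat with (2 * n + 2)%nat by lia.
    change (Init.Nat.pred (S (2 * n))) with (2 * n)%nat.
    change (Init.Nat.pred (S (S (2 * n)))) with (S (2 * n)).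
    rewrite !S_INR, mult_INR, pow_add, <- !tech_pow_Rmult; change (INR 2) with 2.
    set (c := cos x ^ (2 * n)).
    pose proof (sin2_cos2 x) as H; unfold Rsqr in H.
    assert (E : sin x * sin x = 1 - cos x * cos x) by lra.
    simpl pow; ring [E].
  - intros x; apply (ex_derive_continuous (fun x => cos x ^ (2 * S n)
     + 2 * (INR n + 1) ^ 2 * (x ^ 2 * cos x ^ (2 * S n))
     - (INR n + 1) * (2 * INR n + 1) * (x ^ 2 * cos x ^ (2 * n)))); now auto_derive.
  - simpl; ring.
  - rewrite cos_PI2, !pow_i by lia; ring.
  - apply (@is_RInt_minus R_NormedModule); [apply (@is_RInt_plus R_NormedModule)|].
    + apply is_RInt_wallis.
    + apply (@is_RInt_scal R_NormedModule), is_RInt_wallis_sqr.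
    + apply (@is_RInt_scal R_NormedModule), is_RInt_wallis_sqr.
Qed.

Lemma wallis_0 : wallis 0 = PI / 2.
Proof.
  apply is_RInt_unique.
  apply is_RInt_ext with (fun _ => 1); [intros x _; simpl; reflexivity|].
  evar_last; [apply (@is_RInt_const R_NormedModule)|].
  unfold scal; simpl; unfold mult; simpl; ring.
Qed.

Lemma wallis_sqr_0 : wallis_sqr 0 = PI ^ 3 / 24.
Proof.
  apply is_RInt_unique.
  replace (PI ^ 3 / 24) with ((PI / 2) ^ 3 / 3 - 0 ^ 3 / 3) by field.
  apply (is_RInt_derive (fun x => x ^ 3 / 3)).
  - intros x _; auto_derive; [trivial|simpl; field].
  - intros x _; apply (ex_derive_continuous (fun x => x ^ 2 * cos x ^ (2 * 0))); now auto_derive.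
Qed.

Lemma wallis_pos (n : nat) : 0 < wallis n.
Proof.
  induction n as [|n IH].
  - rewrite wallis_0; pose proof PI_RGT_0; lra.
  - pose proof (wallis_rec n); pose proof (pos_INR n); nra.
Qed.

(** The inequality [x <= 2 sin x] replaces [x ^ 2] by [4 sin x ^ 2 = 4 (1 - cos x ^ 2)]. By
    [wallis_rec], the upper bound is [wallis n] times a quantity of order [1 / n]. *)
Lemma wallis_sqr_bounds (n : nat) : 0 <= wallis_sqr n <= 4 * (wallis n - wallis (S n)).
Proof.
  pose proof PI_RGT_0 as HPI.
  assert (Hpow : forall x, 0 <= cos x ^ (2 * n)) by (intros x; rewrite pow_mult; apply pow_le, pow2_ge_0).
  split.
  - apply RInt_ge_0; [lra|eexists; apply is_RInt_wallis_sqr|].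
    intros x _; apply Rmult_le_pos; [apply pow2_ge_0|apply Hpow].
  - apply (is_RInt_le (fun x => x ^ 2 * cos x ^ (2 * n))
             (fun x => 4 * (cos x ^ (2 * n) - cos x ^ (2 * S n))) 0 (PI / 2)).
    + lra.
    + apply is_RInt_wallis_sqr.
    + apply (@is_RInt_scal R_NormedModule), (@is_RInt_minus R_NormedModule); apply is_RInt_wallis.
    + intros x Hx.
      replace (4 * (cos x ^ (2 * n) - cos x ^ (2 * S n))) with (4 * sin x ^ 2 * cos x ^ (2 * n)).
      2: { replace (2 * S n)%nat with (2 * n + 2)%nat by lia; rewrite pow_add.
           pose proof (sin2_cos2 x) as H; unfold Rsqr in H.
           assert (E : sin x * sin x = 1 - cos x * cos x) by lra.
           simpl; ring [E]. }
      apply Rmult_le_compat_r; [apply Hpow|].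
      pose proof (half_le_sin x ltac:(lra)); nra.
Qed.

(* Matsuoka's proof: [wallis_sqr n / wallis n] tends to 0 and decreases by half of
   [1 / (n + 1)^2] at each step. *)
Lemma basel : is_lim_seq (fun n => sum_n (fun k => / (INR k + 1) ^ 2) n) (PI ^ 2 / 6).
Proof.
  set (r := fun n => wallis_sqr n / wallis n).
  assert (Hr : forall n, 0 <= 2 * r (S n) <= 4 * / INR (S n)).
  { intros n; unfold r.
    pose proof (wallis_sqr_bounds (S n)) as [H0 H1]; pose proof (wallis_pos (S n)) as HW.
    pose proof (wallis_rec (S n)) as Hrec.
    assert (HS : 0 < INR (S n)) by (apply lt_0_INR; lia).
    split.
    - apply Rmult_le_pos; [lra|apply Rdiv_le_0_compat; lra].
    - assert (E : wallis (S (S n)) = (2 * INR (S n) + 1) * wallis (S n) / (2 * INR (S n) + 2)).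
      { field_simplify_eq; lra. }
      rewrite E in H1.
      replace (2 * (wallis_sqr (S n) / wallis (S n))) with (2 * wallis_sqr (S n) / wallis (S n))
        by (field; lra).
      apply Rle_div_l; [lra|].
      replace (4 * (wallis (S n) - (2 * INR (S n) + 1) * wallis (S n) / (2 * INR (S n) + 2)))
        with (2 * wallis (S n) * / (INR (S n) + 1)) in H1 by (field; lra).
      assert (/ (INR (S n) + 1) <= / INR (S n)) by (apply Rinv_le_contravar; lra).
      nra. }
  (* The sum telescopes from [2 * r 0], which is [2 (pi ^ 3 / 24) / (pi / 2) = pi ^ 2 / 6]. *)
  assert (Hsum : forall n, sum_n (fun k => / (INR k + 1) ^ 2) n = PI ^ 2 / 6 - 2 * r (S n)).
  { assert (Hstep : forall n, / (INR n + 1) ^ 2 = 2 * r n - 2 * r (S n)).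
    { intros n; unfold r.
      pose proof (wallis_pos n) as H1; pose proof (wallis_pos (S n)) as H2; pose proof (pos_INR n).
      pose proof (wallis_rec n); pose proof (wallis_sqr_rec n).
      assert (E1 : wallis n = (2 * INR n + 2) * wallis (S n) / (2 * INR n + 1))
        by (field_simplify_eq; lra).
      assert (E2 : wallis_sqr n = (wallis (S n) + 2 * (INR n + 1) ^ 2 * wallis_sqr (S n))
                     / ((INR n + 1) * (2 * INR n + 1))) by (field_simplify_eq; [lra|split; lra]).
      rewrite E1, E2; field; repeat split; lra. }
    induction n as [|n IH].
    - rewrite sum_O, Hstep; unfold r; rewrite wallis_0, wallis_sqr_0; as_R_eq; field.
      pose proof (wallis_pos 1); split; [lra|apply PI_neq0].
    - rewrite sum_Sn, IH, Hstep; unfold plus; simpl; as_R_eq; ring. }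
  apply is_lim_seq_ext with (fun n => PI ^ 2 / 6 - 2 * r (S n)); [intros n; now rewrite Hsum|].
  replace (Finite (PI ^ 2 / 6)) with (Finite (PI ^ 2 / 6 - 0)) by (f_equal; ring).
  apply is_lim_seq_minus'; [apply is_lim_seq_const|].
  apply is_lim_seq_le_le with (fun _ => 0) (fun n => 4 * / INR (S n)); [exact Hr|apply is_lim_seq_const|].
  replace (Finite 0) with (Rbar_mult 4 0) by (simpl; f_equal; ring).
  apply is_lim_seq_scal_l, (is_lim_seq_incr_1 (fun n => / INR n)).
  replace (Finite 0) with (Rbar_inv p_infty) by reflexivity.
  apply is_lim_seq_inv; [apply is_lim_seq_INR|easy].
Qed.

(** By partial fractions the sum is a harmonic number and a partial sum of [1 / j ^ 2]. The
    convergence of the sequence defining [euler_gamma] is deduced from the assumed limit [l], which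
    the convergent integral supplies later. *)
Lemma partial_value_limit (l : R) :
  is_lim_seq (fun n => sum_n (fun k => - (INR k / (2 * (INR k + 2) ^ 2))) n
                       - (1 - ln (INR n + 2) / 2 - / (INR n + 2))) l ->
  l = - (3 / 2) + PI ^ 2 / 6 - euler_gamma / 2.
Proof.
  intros Hl.
  set (H := fun n => sum_n_m (fun k => / INR k) 1 n - ln (INR n)).
  (* With [j = k + 2] the indices start at 2; the constants [1/2] and [- 1] remove the terms [j = 1]
     from the two completed sums. *)
  assert (E : forall n, sum_n (fun k => - (INR k / (2 * (INR k + 2) ^ 2))) n
      = / 2 - 1 - sum_n_m (fun k => / INR k) 1 (S (S n)) / 2
        + sum_n (fun k => / (INR k + 1) ^ 2) (S n)).
  { induction n as [|n IH].
    - rewrite sum_O, sum_Sn, sum_O, sum_n_Sm, sum_n_n by lia.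
      unfold plus; simpl; as_R_eq; field.
    - rewrite sum_n_RS, IH, (sum_n_RS _ (S n)), (sum_n_m_RS _ 1 (S (S n))) by lia.
      rewrite !S_INR; pose proof (pos_INR n); as_R_eq; field; lra. }
  assert (Hinv : is_lim_seq (fun n => / (INR n + 2)) 0).
  { apply is_lim_seq_ext with (fun n => / INR (S (S n))).
    - intros n; rewrite !S_INR; f_equal; ring.
    - apply (is_lim_seq_incr_1 (fun n => / INR (S n))), (is_lim_seq_incr_1 (fun n => / INR n)).
      replace (Finite 0) with (Rbar_inv p_infty) by reflexivity.
      apply is_lim_seq_inv; [apply is_lim_seq_INR|easy]. }
  assert (HH : is_lim_seq H (-2 * (l - (PI ^ 2 / 6 - (3 / 2) + 0)))).
  { apply is_lim_seq_incr_1, is_lim_seq_incr_1.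
    apply is_lim_seq_ext with (fun n => -2 * ((sum_n (fun k => - (INR k / (2 * (INR k + 2) ^ 2))) n
        - (1 - ln (INR n + 2) / 2 - / (INR n + 2)))
        - (sum_n (fun k => / (INR k + 1) ^ 2) (S n) - 3 / 2 + / (INR n + 2)))).
    - intros n; unfold H; rewrite E.
      replace (INR (S (S n))) with (INR n + 2) by (rewrite !S_INR; ring); field.
      pose proof (pos_INR n); lra.
    - apply (is_lim_seq_scal_l _ (-2) (l - (PI ^ 2 / 6 - (3 / 2) + 0))), is_lim_seq_minus'.
      + exact Hl.
      + apply is_lim_seq_plus'; [|exact Hinv].
        apply is_lim_seq_minus'; [|apply is_lim_seq_const].
        apply (is_lim_seq_incr_1 (fun n => sum_n (fun k => / (INR k + 1) ^ 2) n)), basel. }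
  assert (Hg : euler_gamma = -2 * (l - (PI ^ 2 / 6 - (3 / 2) + 0))).
  { unfold euler_gamma; fold H; now rewrite (is_lim_seq_unique _ _ HH). }
  rewrite Hg; field.
Qed.

(** * Real-analytic functions *)

Definition is_Rpseries (a : nat -> R) (x l : R) : Prop :=
  @is_pseries R_AbsRing R_NormedModule a x l.

Definition real_analytic_at (f : R -> R) (t : R) : Prop :=
  exists (a : nat -> R) (r : R), 0 < r /\ forall y, Rabs y < r -> is_Rpseries a y (f (t + y)).

Lemma real_analytic_const (c t : R) : real_analytic_at (fun _ => c) t.
Proof.
  exists (fun n => match n with O => c | S _ => 0 end), 1; split; [lra|].
  intros y _ P HP; exists 0%nat; intros n _.
  replace (sum_n _ n) with c; [now apply locally_singleton|].
  symmetry; induction n as [|n IH].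
  - rewrite sum_O; exact (Rmult_1_l c).
  - rewrite sum_n_RS, IH; unfold scal; simpl; unfold mult; simpl; as_R_eq; ring.
Qed.

Lemma real_analytic_plus (f g : R -> R) (t : R) :
  real_analytic_at f t -> real_analytic_at g t -> real_analytic_at (fun x => f x + g x) t.
Proof.
  intros (a & r & Hr & Ha) (b & s & Hs & Hb).
  exists (@PS_plus R_AbsRing R_NormedModule a b), (Rmin r s); split; [now apply Rmin_pos|].
  intros y Hy; apply (@is_pseries_plus R_AbsRing R_NormedModule).
  - apply Ha; pose proof (Rmin_l r s); lra.
  - apply Hb; pose proof (Rmin_r r s); lra.
Qed.

Lemma real_analytic_scal (c : R) (f : R -> R) (t : R) :
  real_analytic_at f t -> real_analytic_at (fun x => c * f x) t.
Proof.
  intros (a & r & Hr & Ha); exists (@PS_scal R_AbsRing R_NormedModule c a), r; split; [exact Hr|].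
  intros y Hy; apply (@is_pseries_scal R_AbsRing R_NormedModule).
  - apply Rmult_comm.
  - now apply Ha.
Qed.

Lemma real_analytic_mul_id (f : R -> R) (t : R) :
  real_analytic_at f t -> real_analytic_at (fun x => x * f x) t.
Proof.
  intros (a & r & Hr & Ha).
  exists (@PS_plus R_AbsRing R_NormedModule (@PS_scal R_AbsRing R_NormedModule t a) (PS_incr_1 a)), r.
  split; [exact Hr|].
  intros y Hy; rewrite Rmult_plus_distr_r.
  apply (@is_pseries_plus R_AbsRing R_NormedModule).
  - apply (@is_pseries_scal R_AbsRing R_NormedModule); [apply Rmult_comm|now apply Ha].
  - apply (@is_pseries_incr_1 R_AbsRing R_NormedModule); now apply Ha.
Qed.

(** Convergence at [r / 2] gives a positive radius, hence continuity at 0, where the sum equals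
    [a 0]. Vanishing is assumed on the right only, because at the edge of the known zero set nothing
    is known on the left. *)
Lemma pseries_coef_0 (a : nat -> R) (r : R) :
  0 < r -> (forall y, 0 < y < r -> is_Rpseries a y 0) -> a 0%nat = 0.
Proof.
  intros Hr Ha.
  assert (HCV : Rbar_le (r / 2) (CV_radius a)).
  { apply Rbar_not_lt_le; intros H.
    apply (CV_disk_outside a (r / 2)); [rewrite Rabs_pos_eq by lra; exact H|].
    apply ex_series_lim_0; exists 0.
    apply is_series_ext with (2 := Ha (r / 2) ltac:(lra)).
    intros n; rewrite pow_n_pow; apply Rmult_comm. }
  assert (Hc : continuity_pt (PSeries a) 0).
  { apply PSeries_continuity; rewrite Rabs_R0.
    apply Rbar_lt_le_trans with (r / 2); [simpl; lra|exact HCV]. }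
  destruct (Req_dec (a 0%nat) 0) as [E|E]; [exact E|exfalso].
  destruct (Hc (Rabs (a 0%nat)) (Rabs_pos_lt _ E)) as [d [Hd H]].
  set (y := Rmin (d / 2) (r / 2)).
  assert (Hy : 0 < y) by (apply Rmin_pos; lra).
  assert (Hyd : y <= d / 2) by apply Rmin_l.
  assert (Hyr : y <= r / 2) by apply Rmin_r.
  specialize (H y).
  assert (Ey : PSeries a y = 0) by (apply is_pseries_unique, Ha; lra).
  simpl in H; unfold Rdist in H; rewrite Ey, PSeries_0 in H.
  replace (0 - a 0%nat) with (- a 0%nat) in H by ring; rewrite Rabs_Ropp in H.
  apply Rlt_irrefl with (Rabs (a 0%nat)), H; repeat split.
  - lra.
  - rewrite Rminus_0_r, Rabs_pos_eq; lra.
Qed.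

(** Once [a 0] is known to vanish, division by [y] shifts the coefficients and preserves the
    hypothesis. *)
Lemma pseries_coef_zero (a : nat -> R) (r : R) (k : nat) :
  0 < r -> (forall y, 0 < y < r -> is_Rpseries a y 0) -> a k = 0.
Proof.
  intros Hr; revert a; induction k as [|k IH]; intros a Ha.
  - now apply pseries_coef_0 with r.
  - apply (IH (fun n => a (S n))).
    intros y Hy.
    replace 0 with (scal (/ y) (plus 0 (opp (a 0%nat)))).
    + apply (@is_pseries_decr_1 R_AbsRing R_NormedModule a y).
      * apply Rinv_l; lra.
      * now apply Ha.
    + rewrite (pseries_coef_0 a r Hr Ha).
      unfold scal, plus, opp; simpl; unfold mult; simpl; as_R_eq; ring.
Qed.

(** At the left edge of the maximal half-line of zeros all Taylor coefficients vanish, so the zeros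
    extend further left, a contradiction. The edge stays at or above [T > 0], where [f] is
    analytic. *)
Lemma real_analytic_identity (f : R -> R) (T : R) :
  0 < T -> (forall t, 0 < t -> real_analytic_at f t) -> (forall t, 1 < t -> f t = 0) -> f T = 0.
Proof.
  intros HT Hf H1.
  destruct (Req_dec (f T) 0) as [E|E]; [exact E|exfalso].
  (* The reflection [t = 2 - s] turns the infimum of the admissible left ends into a least upper
     bound; [s = 1] is the half-line where [f] is known to vanish. *)
  set (A := fun s => forall t, 2 - s < t -> f t = 0).
  destruct (completeness A) as [m [Hub Hlub]].
  - exists (2 - T); intros s Hs; destruct (Rle_dec s (2 - T)) as [H|H]; [exact H|].
    exfalso; apply E, Hs; lra.
  - exists 1; intros t Ht; apply H1; lra.
  - assert (Hm : m <= 2 - T).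
    { apply Hlub; intros s Hs; destruct (Rle_dec s (2 - T)) as [H|H]; [exact H|].
      exfalso; apply E, Hs; lra. }
    assert (Hz : forall t, 2 - m < t -> f t = 0).
    { intros t Ht; destruct (Req_dec (f t) 0) as [Et|Et]; [exact Et|exfalso].
      assert (m <= 2 - t); [|lra].
      apply Hlub; intros s Hs; destruct (Rle_dec s (2 - t)) as [H|H]; [exact H|].
      exfalso; apply Et, Hs; lra. }
    destruct (Hf (2 - m) ltac:(lra)) as (a & r & Hr & Ha).
    assert (Ha0 : forall k, a k = 0).
    { intros k; apply pseries_coef_zero with r; [exact Hr|].
      intros y Hy; rewrite <- (Hz (2 - m + y)) by lra.
      apply Ha; rewrite Rabs_pos_eq; lra. }
    assert (HA : A (m + r / 2)).
    { intros t Ht; destruct (Rlt_dec (2 - m) t) as [H|H]; [now apply Hz|].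
      replace t with (2 - m + (t - (2 - m))) by ring.
      assert (Hy : Rabs (t - (2 - m)) < r) by (apply Rabs_def1; lra).
      rewrite <- (is_pseries_unique _ _ _ (Ha _ Hy)).
      rewrite <- (PSeries_const_0 (t - (2 - m))).
      now apply PSeries_ext. }
    apply Hub in HA; lra.
Qed.

Lemma sum_n_Im (f : nat -> C) (n : nat) :
  Im (@sum_n C_AbsRing f n) = sum_n (fun k => Im (f k)) n.
Proof.
  induction n as [|n IH].
  - now rewrite !sum_O.
  - rewrite !sum_Sn, <- IH; reflexivity.
Qed.

Lemma is_series_Im (f : nat -> C) (l : C) :
  @is_series C_AbsRing C_NormedModule f l ->
  @is_series R_AbsRing R_NormedModule (fun n => Im (f n)) (Im l).
Proof.
  intros H P [eps HP].
  destruct (H (fun z => ball (Im l) eps (Im z))) as [N HN].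
  - exists eps; intros z [_ Hz]; exact Hz.
  - exists N; intros n Hn.
    exact (eq_rect _ P (HP _ (HN n Hn)) _ (sum_n_Im f n)).
Qed.

Lemma pow_n_C_real (y : R) (k : nat) : @pow_n C_Ring (y, 0) k = (y ^ k, 0).
Proof.
  induction k as [|k IH]; [reflexivity|].
  change (@pow_n C_Ring (y, 0) (S k)) with (Cmult (y, 0) (@pow_n C_Ring (y, 0) k)).
  rewrite IH; unfold Cmult; simpl; f_equal; ring.
Qed.

(** Along a horizontal line the increment and its powers are real, so taking imaginary parts acts on
    the coefficients alone. *)
Lemma real_analytic_Im (zeta : C -> C) (t v : R) :
  analytic_at zeta (t, v) -> real_analytic_at (fun x => Im (zeta (x, v))) t.
Proof.
  intros (a & r & Hr & Ha); exists (fun n => Im (a n)), r; split; [exact Hr|].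
  intros y Hy.
  assert (E : Cminus (t + y, v) (t, v) = (y, 0)).
  { unfold Cminus, Cplus, Copp; simpl; f_equal; ring. }
  specialize (Ha (t + y, v)); rewrite E in Ha.
  assert (Hmod : Cmod (y, 0) < r).
  { unfold Cmod; simpl; replace (y * (y * 1) + 0 * (0 * 1)) with (Rsqr y) by (unfold Rsqr; ring).
    rewrite sqrt_Rsqr_abs; exact Hy. }
  apply is_series_ext with (2 := is_series_Im _ _ (Ha Hmod)).
  intros n; rewrite pow_n_C_real; transitivity (y ^ n * Im (a n)).
  - change (y ^ n * Im (a n) + 0 * Re (a n) = y ^ n * Im (a n)); ring.
  - rewrite <- (pow_n_pow y n); reflexivity.
Qed.

(** * Comparison of sums and integrals *)

(** Both [M + f] and [M - f] have nonnegative derivatives; the sign [s] treats them together. *)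
Lemma mean_value_le (f df M dM : R -> R) (a b : R) :
  a <= b -> (forall x, a <= x <= b -> is_derive f x (df x)) ->
  (forall x, a <= x <= b -> is_derive M x (dM x)) ->
  (forall x, a <= x <= b -> Rabs (df x) <= dM x) -> Rabs (f b - f a) <= M b - M a.
Proof.
  intros Hab Hf HM Hle.
  assert (H : forall s, s = 1 \/ s = -1 -> 0 <= (M b + s * f b) - (M a + s * f a)).
  { intros s Hs.
    assert (HD : forall x, a <= x <= b -> is_derive (fun x => M x + s * f x) x (dM x + s * df x)).
    { intros x Hx; apply (is_derive_plus M (fun x => s * f x)); [now apply HM|].
      apply (is_derive_scal f x s); now apply Hf. }
    destruct (MVT_gen (fun x => M x + s * f x) a b (fun x => dM x + s * df x)) as [c [Hc E]].
    - intros x Hx; apply HD; rewrite Rmin_left, Rmax_right in Hx by lra; lra.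
    - intros x Hx; apply derivable_continuous_pt, ex_derive_Reals_0.
      rewrite Rmin_left, Rmax_right in Hx by lra; eexists; now apply HD.
    - rewrite Rmin_left, Rmax_right in Hc by lra.
      rewrite E; apply Rmult_le_pos; [|lra].
      specialize (Hle c Hc); apply Rabs_le_between in Hle; destruct Hs; subst s; lra. }
  pose proof (H 1 (or_introl eq_refl)); pose proof (H (-1) (or_intror eq_refl)).
  apply Rabs_le; lra.
Qed.

(** The index counts the Taylor terms removed, so that differentiation lowers it by one. At index 0
    the truncation of [pred] is correct, the exponential being its own derivative. *)
Fixpoint exp_remainder (K : nat) (z : R) : R :=
  match K with
  | O => exp z
  | S K => exp_remainder K z - z ^ K / INR (fact K)
  end.

Lemma is_derive_exp_remainder (K : nat) (z : R) :
  is_derive (exp_remainder K) z (exp_remainder (pred K) z).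
Proof.
  induction K as [|K IH].
  - apply is_derive_exp.
  - evar_last.
    + apply (is_derive_minus (exp_remainder K) (fun z => z ^ K / INR (fact K))); [exact IH|].
      auto_derive; [trivial|reflexivity].
    + destruct K as [|K]; unfold minus, plus, opp; simpl pred.
      * simpl; as_R_eq; field.
      * change (exp_remainder (S K) z) with (exp_remainder K z - z ^ K / INR (fact K)).
        replace (INR (fact (S K))) with (INR (S K) * INR (fact K)) by (rewrite <- mult_INR; reflexivity).
        pose proof (INR_fact_neq_0 K); pose proof (lt_0_INR (S K) ltac:(lia)).
        simpl plus; as_R_eq; unfold Rdiv.
        change (exp_remainder K z + - (1 * (INR (S K) * z ^ K) * / (INR (S K) * INR (fact K)))
                = exp_remainder K z - z ^ K * / INR (fact K)).
        field; lra.
Qed.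

Lemma exp_remainder_0 (K : nat) : exp_remainder (S K) 0 = 0.
Proof.
  induction K as [|K IH].
  - simpl; rewrite exp_0; field.
  - change (exp_remainder (S K) 0 - 0 ^ S K / INR (fact (S K)) = 0).
    rewrite IH, pow_i by lia; unfold Rdiv; ring.
Qed.

(** Integrating [exp (2 u)] gains a factor [1/2] at each step. The form is chosen for geometric
    decay in [K] at a cost, [exp (2 |z|)], that does not depend on [K]. *)
Lemma exp_remainder_le (K : nat) (z : R) :
  Rabs (exp_remainder K z) <= (/ 2) ^ K * exp (2 * Rabs z).
Proof.
  revert z; induction K as [|K IH]; intros z.
  - simpl; rewrite Rabs_pos_eq, Rmult_1_l by (left; apply exp_pos).
    apply exp_le; pose proof (Rle_abs z); pose proof (Rabs_pos z); lra.
  - assert (H : forall s u, s = 1 \/ s = -1 -> 0 <= u ->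
              Rabs (exp_remainder (S K) (s * u)) <= (/ 2) ^ S K * exp (2 * u)).
    { intros s u Hs Hu.
      pose proof (mean_value_le (fun x => exp_remainder (S K) (s * x))
        (fun x => s * exp_remainder K (s * x)) (fun x => (/ 2) ^ S K * exp (2 * x))
        (fun x => (/ 2) ^ K * exp (2 * x)) 0 u Hu) as HM.
      simpl in HM; rewrite !Rmult_0_r in HM.
      replace (exp_remainder K 0 - 0 ^ K / INR (fact K)) with 0 in HM
        by (symmetry; apply exp_remainder_0).
      rewrite exp_0, Rminus_0_r in HM.
      apply Rle_trans with (/ 2 * (/ 2) ^ K * exp (2 * u) - / 2 * (/ 2) ^ K * 1).
      - apply HM.
        + intros x _; apply (is_derive_comp (exp_remainder (S K)) (fun x => s * x)).
          * apply (is_derive_exp_remainder (S K)).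
          * auto_derive; [trivial|ring].
        + intros x _; auto_derive; [trivial|field].
        + intros x Hx.
          assert (Habs : Rabs s = 1) by (destruct Hs; subst s; [apply Rabs_R1|rewrite Rabs_left; lra]).
          rewrite Rabs_mult, Habs, Rmult_1_l.
          eapply Rle_trans; [apply IH|].
          rewrite Rabs_mult, Habs, (Rabs_pos_eq x), Rmult_1_l by lra; lra.
      - assert (0 <= (/ 2) ^ K) by (apply pow_le; lra); simpl; lra. }
    destruct (Rle_dec 0 z) as [Hz|Hz].
    + rewrite (Rabs_pos_eq z) by lra.
      rewrite <- (Rmult_1_l z) at 1; apply H; auto.
    + rewrite (Rabs_left z) by lra.
      replace z with (-1 * - z) at 1 by ring; apply H; [auto|lra].
Qed.

(* The imaginary part of [x ^ (- s)] at [s = t + i v], followed by a primitive of it in [x],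
   the imaginary part of [x ^ (1 - s) / (1 - s)]. *)
Definition npow_im (v t x : R) : R := - (exp (- t * ln x) * sin (v * ln x)).

Definition npow_im_primitive (v t x : R) : R :=
  exp ((1 - t) * ln x) * (v * cos (v * ln x) - (1 - t) * sin (v * ln x)) / ((1 - t) ^ 2 + v ^ 2).

Lemma is_derive_npow_im_primitive (v t x : R) :
  v <> 0 -> 0 < x -> is_derive (npow_im_primitive v t) x (npow_im v t x).
Proof.
  intros Hv Hx; unfold npow_im_primitive, npow_im.
  assert (HQ : 0 < (1 - t) ^ 2 + v ^ 2).
  { pose proof (pow2_ge_0 (1 - t)); pose proof (pow2_gt_0 v Hv); lra. }
  auto_derive; [tauto|].
  replace (exp (- t * ln x)) with (exp ((1 - t) * ln x) * / x).
  2: { rewrite <- (exp_ln x Hx) at 2; rewrite <- exp_Ropp, <- exp_plus; f_equal; ring. }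
  field; split; lra.
Qed.

(** Summed over [n <= N], these errors compare [f 2 + ... + f (N + 2)] with the integral of [f] from
    1 to [N + 2]. The missing [f 1] is 0 for [npow_im], because [ln 1 = 0]. *)
Definition step_error (f : R -> R) (n : nat) : R :=
  f (INR n + 2) - RInt f (INR n + 1) (INR n + 2).

Lemma ex_RInt_step (f : R -> R) (n : nat) :
  (forall x, 0 < x -> ex_derive f x) -> ex_RInt f (INR n + 1) (INR n + 2).
Proof.
  intros Hf; pose proof (pos_INR n); apply (@ex_RInt_continuous R_CompleteNormedModule).
  intros x Hx; rewrite Rmin_left in Hx by lra; apply (ex_derive_continuous f), Hf; lra.
Qed.

Lemma step_error_ext (f g : R -> R) (n : nat) :
  (forall x, 0 < x -> f x = g x) -> step_error f n = step_error g n.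
Proof.
  intros H; pose proof (pos_INR n); unfold step_error; rewrite H by lra.
  rewrite (RInt_ext f g); [reflexivity|].
  intros x Hx; rewrite Rmin_left in Hx by lra; apply H; lra.
Qed.

Lemma step_error_minus_scal (f g : R -> R) (c : R) (n : nat) :
  (forall x, 0 < x -> ex_derive f x) -> (forall x, 0 < x -> ex_derive g x) ->
  step_error (fun x => f x - c * g x) n = step_error f n - c * step_error g n.
Proof.
  intros Hf Hg; unfold step_error.
  assert (E : RInt (fun x => f x - c * g x) (INR n + 1) (INR n + 2)
      = RInt f (INR n + 1) (INR n + 2) - c * RInt g (INR n + 1) (INR n + 2)).
  { apply is_RInt_unique, (@is_RInt_minus R_NormedModule).
    - apply (@RInt_correct R_CompleteNormedModule); now apply ex_RInt_step.
    - apply (@is_RInt_scal R_NormedModule), (@RInt_correct R_CompleteNormedModule).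
      now apply ex_RInt_step. }
  rewrite E; ring.
Qed.

(** The error is the mean of [f (n + 2) - f x] over the unit step, and each such difference is
    bounded by an increment of [M]. *)
Lemma step_error_le (f df M dM : R -> R) (n : nat) :
  (forall x, 0 < x -> is_derive f x (df x)) -> (forall x, 0 < x -> is_derive M x (dM x)) ->
  (forall x, 1 <= x -> Rabs (df x) <= dM x) ->
  Rabs (step_error f n) <= M (INR n + 2) - M (INR n + 1).
Proof.
  intros Hf HM Hle; pose proof (pos_INR n) as Hn.
  assert (Hex : ex_RInt f (INR n + 1) (INR n + 2)) by (apply ex_RInt_step; eexists; now apply Hf).
  assert (E : is_RInt (fun x => f (INR n + 2) - f x) (INR n + 1) (INR n + 2) (step_error f n)).
  { unfold step_error.
    apply (@is_RInt_minus R_NormedModule).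
    - evar_last; [apply (@is_RInt_const R_NormedModule)|].
      change ((INR n + 2 - (INR n + 1)) * f (INR n + 2) = f (INR n + 2)); ring.
    - now apply (@RInt_correct R_CompleteNormedModule). }
  rewrite <- (is_RInt_unique _ _ _ _ E).
  replace (M (INR n + 2) - M (INR n + 1))
    with ((INR n + 2 - (INR n + 1)) * (M (INR n + 2) - M (INR n + 1))) by ring.
  apply abs_RInt_le_const; [lra|eexists; exact E|].
  intros x Hx.
  apply Rle_trans with (M (INR n + 2) - M x).
  - apply mean_value_le with df dM; try lra; intros z Hz;
      [apply Hf|apply HM|apply Hle]; lra.
  - assert (H : Rabs (f x - f (INR n + 1)) <= M x - M (INR n + 1)).
    { apply mean_value_le with df dM; try lra; intros z Hz;
        [apply Hf|apply HM|apply Hle]; lra. }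
    pose proof (Rabs_pos (f x - f (INR n + 1))); lra.
Qed.

Lemma telescoping_series (a b : nat -> R) :
  (forall n, Rabs (a n) <= b n - b (S n)) -> is_lim_seq b 0 ->
  ex_series a /\ Rabs (Series a) <= b O /\ forall n, Rabs (Series a - sum_n a n) <= b (S n).
Proof.
  intros Hab Hb.
  assert (Hsum : forall n m, Rabs (sum_n a (n + m) - sum_n a n) <= b (S n) - b (S (n + m))).
  { intros n m; induction m as [|m IH].
    - rewrite Nat.add_0_r, !Rminus_diag, Rabs_R0; lra.
    - rewrite Nat.add_succ_r, sum_n_RS.
      replace (sum_n a (n + m) + a (S (n + m)) - sum_n a n)
        with ((sum_n a (n + m) - sum_n a n) + a (S (n + m))) by ring.
      pose proof (Rabs_triang (sum_n a (n + m) - sum_n a n) (a (S (n + m)))).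
      specialize (Hab (S (n + m))); lra. }
  assert (Hpos : forall n, 0 <= b n).
  { intros n; apply (is_lim_seq_decr_compare b 0 Hb).
    intros k; specialize (Hab k); pose proof (Rabs_pos (a k)); lra. }
  assert (Hex : ex_series a).
  { apply (@ex_series_le R_AbsRing R_CompleteNormedModule a (fun n => b n - b (S n))); [exact Hab|].
    assert (HS : forall n, b O - b (S n) = sum_n (fun n => b n - b (S n)) n).
    { induction n as [|n IH]; [now rewrite sum_O|].
      rewrite sum_n_RS, <- IH; ring. }
    exists (b O - 0).
    apply (filterlim_ext _ _ HS).
    apply (is_lim_seq_minus' (fun _ => b O) (fun n => b (S n))); [apply is_lim_seq_const|].
    now apply is_lim_seq_incr_1 in Hb. }
  assert (Htail : forall n, Rabs (Series a - sum_n a n) <= b (S n)).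
  { intros n.
    assert (HL : is_lim_seq (fun m => Rabs (sum_n a (n + m) - sum_n a n)) (Rabs (Series a - sum_n a n))).
    { apply (is_lim_seq_abs _ (Series a - sum_n a n)), is_lim_seq_minus'; [|apply is_lim_seq_const].
      apply is_lim_seq_ext with (fun m => sum_n a (m + n)); [intros m; now rewrite Nat.add_comm|].
      apply (is_lim_seq_incr_n (sum_n a) n), Series_correct, Hex. }
    apply (is_lim_seq_le _ _ _ _ (fun m => Rle_trans _ _ (b (S n)) (Hsum n m)
             ltac:(specialize (Hpos (S (n + m))); lra)) HL (is_lim_seq_const _)). }
  repeat split; [exact Hex| |exact Htail].
  specialize (Htail O); specialize (Hab O); rewrite sum_O in Htail.
  replace (Series a) with ((Series a - a O) + a O) by ring.
  pose proof (Rabs_triang (Series a - a O) (a O)); lra.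
Qed.

(** * Approximation of zeta in the half-plane of positive real part *)

(* Remainder and coefficients of the Taylor expansion of [npow_im v (t + y) x] in [y]. *)
Definition npow_im_remainder (v t y : R) (K : nat) (x : R) : R :=
  - (exp (- t * ln x) * sin (v * ln x) * exp_remainder K (- y * ln x)).

Definition npow_im_coef (v t : R) (K : nat) (x : R) : R :=
  - (exp (- t * ln x) * sin (v * ln x) * ((- ln x) ^ K / INR (fact K))).

Definition npow_im_remainder' (v t y : R) (K : nat) (x : R) : R :=
  exp (- t * ln x) / x * (t * sin (v * ln x) * exp_remainder K (- y * ln x)
    - v * cos (v * ln x) * exp_remainder K (- y * ln x)
    + y * sin (v * ln x) * exp_remainder (pred K) (- y * ln x)).

Lemma is_derive_npow_im_remainder (v t y x : R) (K : nat) :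
  0 < x -> is_derive (npow_im_remainder v t y K) x (npow_im_remainder' v t y K x).
Proof.
  intros Hx.
  assert (HE : is_derive (fun x => exp_remainder K (- y * ln x)) x
                 (- y / x * exp_remainder (pred K) (- y * ln x))).
  { apply (is_derive_comp (exp_remainder K) (fun x => - y * ln x)).
    - apply is_derive_exp_remainder.
    - auto_derive; [exact Hx|field; lra]. }
  assert (HG : is_derive (fun x => - (exp (- t * ln x) * sin (v * ln x))) x
                 (exp (- t * ln x) / x * (t * sin (v * ln x) - v * cos (v * ln x)))).
  { auto_derive; [auto|field; lra]. }
  apply is_derive_ext with (fun x => - (exp (- t * ln x) * sin (v * ln x)) * exp_remainder K (- y * ln x)).
  - intros z; unfold npow_im_remainder; as_R_eq; ring.
  - evar_last; [apply (is_derive_mult _ _ _ _ _ HG HE); intros; apply Rmult_comm|].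
    unfold npow_im_remainder', plus, mult; simpl; as_R_eq; field; lra.
Qed.

Lemma is_derive_tail (C d x : R) :
  d <> 0 -> 0 < x -> is_derive (fun x => - (C / d * exp (- d * ln x))) x (C * exp (- d * ln x) / x).
Proof. intros Hd Hx; auto_derive; [exact Hx|field; lra]. Qed.

(** For [|y| <= t / 4] the cost [exp (2 |y| ln x)] is at most [x ^ (t / 2)], which uses up half of
    the decay [x ^ (- t)]. The rest, divided by [x], is integrable at infinity. *)
Lemma npow_im_remainder'_le (v t y x : R) (K : nat) :
  0 < t -> Rabs y <= t / 4 -> 1 <= x ->
  Rabs (npow_im_remainder' v t y K x)
  <= (/ 2) ^ K * (Rabs v + 2 * t) * exp (- (t / 2) * ln x) / x.
Proof.
  intros Ht Hy Hx.
  assert (Hl : 0 <= ln x) by (rewrite <- ln_1; apply ln_le; lra).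
  set (l := ln x) in *; set (p := (/ 2) ^ K * exp (t / 2 * l)).
  assert (Hz : Rabs (- y * l) <= t / 4 * l).
  { rewrite Rabs_mult, Rabs_Ropp, (Rabs_pos_eq l) by lra; now apply Rmult_le_compat_r. }
  assert (H2K : 0 < (/ 2) ^ K) by (apply pow_lt; lra).
  assert (He : exp (2 * Rabs (- y * l)) <= exp (t / 2 * l)) by (apply exp_le; lra).
  assert (HA : Rabs (exp_remainder K (- y * l)) <= p).
  { eapply Rle_trans; [apply exp_remainder_le|]; apply Rmult_le_compat_l; lra. }
  (* Passing to [pred K] loses at most a factor 2 in [(1/2) ^ K]; for [K = 0] nothing is lost. *)
  assert (HB : Rabs (exp_remainder (pred K) (- y * l)) <= 2 * p).
  { eapply Rle_trans; [apply exp_remainder_le|].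
    unfold p; rewrite <- Rmult_assoc.
    pose proof (exp_pos (2 * Rabs (- y * l))).
    apply Rmult_le_compat; try lra; [apply pow_le; lra|].
    destruct K as [|K]; simpl; [lra|].
    simpl in H2K; lra. }
  assert (Hp : 0 <= p) by (pose proof (Rabs_pos (exp_remainder K (- y * l))); lra).
  unfold npow_im_remainder'; fold l.
  replace ((/ 2) ^ K * (Rabs v + 2 * t) * exp (- (t / 2) * l) / x)
    with (exp (- t * l) / x * (p * (Rabs v + 2 * t))).
  2: { unfold p; replace (- (t / 2) * l) with (- t * l + t / 2 * l) by field.
       rewrite exp_plus; field; lra. }
  assert (Hc : 0 <= exp (- t * l) / x) by (apply Rdiv_le_0_compat; [left; apply exp_pos|lra]).
  rewrite Rabs_mult, (Rabs_pos_eq _ Hc); apply Rmult_le_compat_l; [exact Hc|].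
  set (A := exp_remainder K _) in *; set (B := exp_remainder (pred K) _) in *.
  assert (Hmul : forall a b c q m, Rabs a <= m -> Rabs b <= 1 -> Rabs c <= q ->
            Rabs (a * b * c) <= m * q).
  { intros a b c q m Ha Hb Hq; rewrite !Rabs_mult.
    pose proof (Rabs_pos a); pose proof (Rabs_pos b); pose proof (Rabs_pos c).
    apply Rmult_le_compat; try lra; [apply Rmult_le_pos; lra|].
    rewrite <- (Rmult_1_r m); apply Rmult_le_compat; lra. }
  pose proof (Hmul t (sin (v * l)) A p t ltac:(rewrite Rabs_pos_eq; lra) (Rabs_sin_le_1 _) HA) as M1.
  pose proof (Hmul v (cos (v * l)) A p (Rabs v) (Rle_refl _) (Rabs_cos_le_1 _) HA) as M2.
  pose proof (Hmul y (sin (v * l)) B (2 * p) (t / 4) Hy (Rabs_sin_le_1 _) HB) as M3.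
  apply Rabs_le_between in M1; apply Rabs_le_between in M2; apply Rabs_le_between in M3.
  assert (0 <= t * p) by (apply Rmult_le_pos; lra).
  apply Rabs_le; split; lra.
Qed.

(** The integral over [[n + 1, infinity)] of the bound in [npow_im_remainder'_le] at [K = 0]. For
    [t = 1/2] it is [4 (1 + |v|) (n + 1) ^ (- 1/4)]. *)
Definition tail_bound (v t : R) (n : nat) : R :=
  (Rabs v + 2 * t) / (t / 2) * exp (- (t / 2) * ln (INR n + 1)).

Lemma step_error_remainder_le (v t y : R) (K n : nat) :
  0 < t -> Rabs y <= t / 4 ->
  Rabs (step_error (npow_im_remainder v t y K) n)
  <= (/ 2) ^ K * tail_bound v t n - (/ 2) ^ K * tail_bound v t (S n).
Proof.
  intros Ht Hy.
  set (C := (/ 2) ^ K * (Rabs v + 2 * t)).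
  replace ((/ 2) ^ K * tail_bound v t n - (/ 2) ^ K * tail_bound v t (S n))
    with (- (C / (t / 2) * exp (- (t / 2) * ln (INR n + 2)))
          - - (C / (t / 2) * exp (- (t / 2) * ln (INR n + 1)))).
  2: { unfold tail_bound, C; rewrite S_INR; replace (INR n + 1 + 1) with (INR n + 2) by ring.
       field; lra. }
  apply (step_error_le _ (npow_im_remainder' v t y K)
           (fun x => - (C / (t / 2) * exp (- (t / 2) * ln x)))
           (fun x => C * exp (- (t / 2) * ln x) / x)).
  - intros x Hx; now apply is_derive_npow_im_remainder.
  - intros x Hx; apply is_derive_tail; lra.
  - intros x Hx; now apply npow_im_remainder'_le.
Qed.

Lemma is_lim_seq_exp_ln (d : R) : 0 < d -> is_lim_seq (fun n => exp (- d * ln (INR n + 1))) 0.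
Proof.
  intros Hd.
  apply is_lim_seq_ext with (fun n => exp (- d * ln (INR (S n)))).
  { intros n; now rewrite S_INR. }
  apply (is_lim_seq_incr_1 (fun n => exp (- d * ln (INR n)))).
  apply (is_lim_comp_seq (fun v => exp (- d * v)) (fun n => ln (INR n)) p_infty 0).
  - now apply is_lim_exp_neg.
  - exists 0%nat; easy.
  - apply (is_lim_comp_seq ln INR p_infty p_infty).
    + apply is_lim_ln_p.
    + exists 0%nat; easy.
    + apply is_lim_seq_INR.
Qed.

Lemma tail_bound_lim (v t : R) : 0 < t -> is_lim_seq (tail_bound v t) 0.
Proof.
  intros Ht; replace (Finite 0) with (Rbar_mult ((Rabs v + 2 * t) / (t / 2)) 0)
    by (simpl; f_equal; ring).
  apply is_lim_seq_scal_l, is_lim_seq_exp_ln; lra.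
Qed.

Lemma remainder_series (v t y : R) (K : nat) :
  0 < t -> Rabs y <= t / 4 ->
  let a := step_error (npow_im_remainder v t y K) in
  ex_series a /\ Rabs (Series a) <= (/ 2) ^ K * tail_bound v t O /\
  forall n, Rabs (Series a - sum_n a n) <= (/ 2) ^ K * tail_bound v t (S n).
Proof.
  intros Ht Hy a.
  apply (telescoping_series a (fun n => (/ 2) ^ K * tail_bound v t n)).
  - intros n; now apply step_error_remainder_le.
  - replace (Finite 0) with (Rbar_mult ((/ 2) ^ K) 0) by (simpl; f_equal; ring).
    now apply is_lim_seq_scal_l, tail_bound_lim.
Qed.

Lemma npow_im_remainder_S (v t y : R) (K : nat) (x : R) :
  npow_im_remainder v t y (S K) x = npow_im_remainder v t y K x - y ^ K * npow_im_coef v t K x.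
Proof.
  unfold npow_im_remainder, npow_im_coef; simpl exp_remainder.
  replace (- y * ln x) with (y * - ln x) by ring; rewrite Rpow_mult_distr.
  unfold Rdiv; ring.
Qed.

Lemma npow_im_remainder_0 (v t y x : R) : npow_im_remainder v t y 0 x = npow_im v (t + y) x.
Proof.
  unfold npow_im_remainder, npow_im; simpl exp_remainder.
  replace (- (t + y) * ln x) with (- t * ln x + - y * ln x) by ring; rewrite exp_plus; ring.
Qed.

Lemma ex_derive_npow_im_coef (v t : R) (K : nat) (x : R) : 0 < x -> ex_derive (npow_im_coef v t K) x.
Proof. intros Hx; unfold npow_im_coef; auto_derive; auto. Qed.

Lemma step_error_remainder_S (v t y : R) (K n : nat) :
  step_error (npow_im_remainder v t y (S K)) n
  = step_error (npow_im_remainder v t y K) n - y ^ K * step_error (npow_im_coef v t K) n.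
Proof.
  rewrite <- step_error_minus_scal.
  - apply step_error_ext; intros x _; apply npow_im_remainder_S.
  - intros x Hx; eexists; now apply is_derive_npow_im_remainder.
  - intros x Hx; now apply ex_derive_npow_im_coef.
Qed.

(** For [t > 0] and [v <> 0] this turns out to be the imaginary part of [zeta s - 1 / (s - 1)], the
    zeta function with its pole removed. *)
Definition zeta_correction (v t : R) : R := Series (step_error (npow_im v t)).

(** Each Taylor coefficient is a difference of two consecutive remainders divided by [y ^ K];
    [y = t / 4] is an admissible nonzero choice. *)
Lemma ex_series_coef (v t : R) (K : nat) : 0 < t -> ex_series (step_error (npow_im_coef v t K)).
Proof.
  intros Ht.
  assert (Hy : Rabs (t / 4) <= t / 4) by (rewrite Rabs_pos_eq; lra).
  destruct (remainder_series v t (t / 4) K Ht Hy) as [H1 _].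
  destruct (remainder_series v t (t / 4) (S K) Ht Hy) as [H2 _].
  assert (Hp : (t / 4) ^ K <> 0) by (apply pow_nonzero; lra).
  apply ex_series_ext with (fun n => scal (/ (t / 4) ^ K)
    (plus (step_error (npow_im_remainder v t (t / 4) K) n)
          (opp (step_error (npow_im_remainder v t (t / 4) (S K)) n)))).
  - intros n; rewrite step_error_remainder_S.
    unfold scal, plus, opp; simpl; unfold mult; simpl; as_R_eq; field.
    lra.
  - apply (@ex_series_scal R_AbsRing R_NormedModule), (@ex_series_minus R_AbsRing R_NormedModule);
      assumption.
Qed.

(** Summation over [n] is exchanged with the Taylor expansion by following the remainder: after [K]
    terms, its sum over [n] is at most [(1/2) ^ K] times a constant, uniformly for
    [|y| <= t / 4]. *)
Lemma real_analytic_zeta_correction (v t : R) : 0 < t -> real_analytic_at (zeta_correction v) t.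
Proof.
  intros Ht.
  set (a := fun K => Series (step_error (npow_im_coef v t K))).
  exists a, (t / 4); split; [lra|].
  intros y Hy.
  set (rho := fun K => Series (step_error (npow_im_remainder v t y K))).
  assert (Hrho : forall K, rho (S K) = rho K - y ^ K * a K).
  { intros K; unfold rho, a.
    rewrite <- Series_scal_l, <- Series_minus.
    - apply Series_ext; intros n; apply step_error_remainder_S.
    - apply remainder_series; lra.
    - apply (@ex_series_scal R_AbsRing R_NormedModule), ex_series_coef, Ht. }
  assert (Hsum : forall K, zeta_correction v (t + y) - rho (S K) = sum_n (fun K => y ^ K * a K) K).
  { assert (H0 : zeta_correction v (t + y) = rho O).
    { unfold zeta_correction, rho; apply Series_ext; intros n.
      apply step_error_ext; intros x _; symmetry; apply npow_im_remainder_0. }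
    induction K as [|K IH].
    - rewrite sum_O, Hrho, H0; as_R_eq; ring.
    - rewrite sum_n_RS, <- IH, (Hrho (S K)); ring. }
  assert (Hlim : is_lim_seq (fun K => zeta_correction v (t + y) - rho (S K)) (zeta_correction v (t + y))).
  { replace (Finite (zeta_correction v (t + y))) with (Finite (zeta_correction v (t + y) - 0))
      by (f_equal; ring).
    apply is_lim_seq_minus'; [apply is_lim_seq_const|].
    apply (is_lim_seq_incr_1 rho).
    apply is_lim_seq_abs_0.
    apply is_lim_seq_le_le with (fun _ => 0) (fun K => tail_bound v t 0 * (/ 2) ^ K).
    - intros K; split; [apply Rabs_pos|].
      rewrite Rmult_comm; apply (remainder_series v t y K Ht ltac:(lra)).
    - apply is_lim_seq_const.
    - replace (Finite 0) with (Rbar_mult (tail_bound v t 0) 0) by (simpl; f_equal; ring).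
      apply is_lim_seq_scal_l, is_lim_seq_geom; rewrite Rabs_pos_eq; lra. }
  apply is_series_ext with (fun K => y ^ K * a K).
  - intros K; rewrite <- (pow_n_pow y K); reflexivity.
  - apply (filterlim_ext _ _ Hsum), Hlim.
Qed.

(** The integrals telescope through the primitive, whose value at 1 is [v / ((1 - t) ^ 2 + v ^ 2)].
    The sum on the right may start at [x = 1] because that term is 0. *)
Lemma sum_step_error (v t : R) (n : nat) :
  v <> 0 ->
  sum_n (step_error (npow_im v t)) n
  = sum_n (fun k => npow_im v t (INR k + 1)) (S n)
    - (npow_im_primitive v t (INR n + 2) - v / ((1 - t) ^ 2 + v ^ 2)).
Proof.
  intros Hv.
  assert (HQ : 0 < (1 - t) ^ 2 + v ^ 2).
  { pose proof (pow2_ge_0 (1 - t)); pose proof (pow2_gt_0 v Hv); lra. }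
  assert (H1 : npow_im v t 1 = 0).
  { unfold npow_im; rewrite ln_1, !Rmult_0_r, sin_0; ring. }
  assert (HP1 : npow_im_primitive v t 1 = v / ((1 - t) ^ 2 + v ^ 2)).
  { unfold npow_im_primitive; rewrite ln_1, !Rmult_0_r, sin_0, cos_0, exp_0; field; lra. }
  assert (Hstep : forall k, step_error (npow_im v t) k = npow_im v t (INR k + 2)
            - (npow_im_primitive v t (INR k + 2) - npow_im_primitive v t (INR k + 1))).
  { intros k; pose proof (pos_INR k); unfold step_error; f_equal; f_equal.
    apply is_RInt_unique, (is_RInt_derive (npow_im_primitive v t)).
    - intros x Hx; rewrite Rmin_left in Hx by lra; apply is_derive_npow_im_primitive; [exact Hv|lra].
    - intros x Hx; rewrite Rmin_left in Hx by lra.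
      apply (ex_derive_continuous (npow_im v t)); unfold npow_im; auto_derive.
      assert (0 < x) by lra; auto. }
  induction n as [|n IH].
  - rewrite sum_O, sum_n_RS, sum_O, Hstep; simpl INR.
    rewrite !Rplus_0_l, H1, HP1; replace (1 + 1) with 2 by ring; as_R_eq; ring.
  - rewrite sum_n_RS, IH, (sum_n_RS _ (S n)), Hstep, !S_INR.
    replace (INR n + 1 + 1 + 1) with (INR n + 1 + 2) by ring.
    replace (INR n + 1 + 1) with (INR n + 2) by ring; as_R_eq; ring.
Qed.

Lemma Im_Rpow_C (x t v : R) : Im (Rpow_C x (- (t, v))%C) = npow_im v t x.
Proof.
  unfold Rpow_C, Cexp, npow_im; simpl.
  replace (- t * ln x - - v * 0) with (- t * ln x) by ring.
  replace (- t * 0 + - v * ln x) with (- (v * ln x)) by ring.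
  rewrite sin_neg; ring.
Qed.

(** For [t > 1] the Dirichlet series converges and the primitive at [N] is [O (N ^ (1 - t))], so
    only its value at 1 survives in the limit of [sum_step_error]. *)
Lemma Im_zeta_dirichlet (zeta : C -> C) (v t : R) :
  is_riemann_zeta zeta -> v <> 0 -> 1 < t ->
  Im (zeta (t, v)) = zeta_correction v t - v / ((1 - t) ^ 2 + v ^ 2).
Proof.
  intros [_ Hz] Hv Ht.
  specialize (Hz (t, v) Ht); apply is_series_Im in Hz.
  assert (HQ : 0 < (1 - t) ^ 2 + v ^ 2).
  { pose proof (pow2_ge_0 (1 - t)); pose proof (pow2_gt_0 v Hv); lra. }
  assert (HS : is_lim_seq (fun n => sum_n (fun k => npow_im v t (INR k + 1)) n) (Im (zeta (t, v)))).
  { apply (is_series_ext _ (fun k => npow_im v t (INR k + 1))) in Hz; [exact Hz|].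
    intros n; rewrite Im_Rpow_C, S_INR; reflexivity. }
  assert (HP : is_lim_seq (fun n => npow_im_primitive v t (INR n + 2)) 0).
  { apply is_lim_seq_ext with (fun n => npow_im_primitive v t (INR (S n) + 1)).
    { intros n; rewrite S_INR; f_equal; ring. }
    apply (is_lim_seq_incr_1 (fun n => npow_im_primitive v t (INR n + 1))), is_lim_seq_abs_0.
    apply is_lim_seq_le_le with (fun _ => 0) (fun n => (Rabs v + (t - 1)) / ((1 - t) ^ 2 + v ^ 2)
                                                     * exp (- (t - 1) * ln (INR n + 1))).
    - intros n; split; [apply Rabs_pos|].
      unfold npow_im_primitive; set (l := ln (INR n + 1)).
      replace (- (t - 1) * l) with ((1 - t) * l) by ring.
      unfold Rdiv; rewrite !Rabs_mult, Rabs_inv, (Rabs_pos_eq ((1 - t) ^ 2 + v ^ 2)),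
        (Rabs_pos_eq (exp _)) by (try apply Rlt_le, exp_pos; lra).
      rewrite (Rmult_comm (_ * / _)), Rmult_assoc.
      apply Rmult_le_compat_l; [left; apply exp_pos|].
      apply Rmult_le_compat_r; [left; now apply Rinv_0_lt_compat|].
      pose proof (Rabs_triang (v * cos (v * l)) (- ((1 - t) * sin (v * l)))) as H.
      rewrite Rabs_Ropp, !Rabs_mult, (Rabs_left (1 - t)) in H by lra.
      pose proof (Rabs_sin_le_1 (v * l)); pose proof (Rabs_cos_le_1 (v * l)).
      pose proof (Rabs_pos v); unfold Rminus in *; nra.
    - apply is_lim_seq_const.
    - replace (Finite 0) with (Rbar_mult ((Rabs v + (t - 1)) / ((1 - t) ^ 2 + v ^ 2)) 0)
        by (simpl; f_equal; ring).
      apply is_lim_seq_scal_l, is_lim_seq_exp_ln; lra. }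
  assert (HV : is_series (step_error (npow_im v t))
                 (Im (zeta (t, v)) - (0 - v / ((1 - t) ^ 2 + v ^ 2)))).
  { apply (filterlim_ext _ _ (fun n => eq_sym (sum_step_error v t n Hv))).
    apply is_lim_seq_minus'.
    - now apply is_lim_seq_incr_1 in HS.
    - apply is_lim_seq_minus'; [exact HP|apply is_lim_seq_const]. }
  apply is_series_unique in HV; unfold zeta_correction; rewrite HV; ring.
Qed.

(** With [v <> 0] the whole horizontal line avoids the pole, so the identity for [t > 1] propagates
    along it to all [t > 0]. *)
Lemma Im_zeta_formula (zeta : C -> C) (v t : R) :
  is_riemann_zeta zeta -> v <> 0 -> 0 < t ->
  Im (zeta (t, v)) = zeta_correction v t - v / ((1 - t) ^ 2 + v ^ 2).
Proof.
  intros Hz Hv Ht.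
  assert (HQ : forall t, 0 < (1 - t) ^ 2 + v ^ 2).
  { clear t Ht; intros t; pose proof (pow2_ge_0 (1 - t)); pose proof (pow2_gt_0 v Hv); lra. }
  set (d := fun t => Im (zeta (t, v)) + -1 * zeta_correction v t).
  (* multiplied by the denominator, so that only products with the variable are needed *)
  set (h := fun t => t * (t * d t) + (-2 * (t * d t) + ((1 + v ^ 2) * d t + v))).
  assert (Hh : h t = 0).
  { apply real_analytic_identity with (1 := Ht).
    - clear t Ht; intros t Ht.
      assert (Hd : real_analytic_at d t).
      { apply real_analytic_plus.
        - apply real_analytic_Im, Hz; intros E; apply Hv; injection E; auto.
        - apply real_analytic_scal, real_analytic_zeta_correction, Ht. }
      apply real_analytic_plus; [now apply real_analytic_mul_id, real_analytic_mul_id|].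
      apply real_analytic_plus; [now apply real_analytic_scal, real_analytic_mul_id|].
      apply real_analytic_plus; [now apply real_analytic_scal|apply real_analytic_const].
    - clear t Ht; intros t Ht; unfold h, d; rewrite (Im_zeta_dirichlet zeta v t Hz Hv Ht).
      specialize (HQ t); field; lra. }
  specialize (HQ t).
  assert (E : ((1 - t) ^ 2 + v ^ 2) * d t = - v) by (unfold h in Hh; lra).
  assert (Ed : d t = - v / ((1 - t) ^ 2 + v ^ 2)) by (rewrite <- E; field; lra).
  unfold d in Ed; unfold Rdiv in *; lra.
Qed.

(** The two copies of [v / ((1 - t) ^ 2 + v ^ 2)] cancel and the difference is a tail of the series
    [zeta_correction]; it is estimated by the remainder bound at [K = 0], [y = 0]. *)
Lemma Im_zeta_approx (zeta : C -> C) (v t : R) (n : nat) :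
  is_riemann_zeta zeta -> v <> 0 -> 0 < t ->
  Rabs (Im (zeta (t, v)) - (sum_n (fun k => npow_im v t (INR k + 1)) (S n)
                            - npow_im_primitive v t (INR n + 2)))
  <= tail_bound v t (S n).
Proof.
  intros Hz Hv Ht; rewrite (Im_zeta_formula zeta v t Hz Hv Ht).
  destruct (remainder_series v t 0 0 Ht ltac:(rewrite Rabs_R0; lra)) as (_ & _ & H).
  specialize (H n); simpl pow in H; rewrite Rmult_1_l in H.
  assert (E : forall k, step_error (npow_im_remainder v t 0 0) k = step_error (npow_im v t) k).
  { intros k; apply step_error_ext; intros x _; now rewrite npow_im_remainder_0, Rplus_0_r. }
  rewrite (Series_ext _ _ E), (sum_n_Rext _ _ _ E), (sum_step_error v t n Hv) in H.
  unfold zeta_correction; eapply Rle_trans; [|exact H]; right; f_equal; ring.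
Qed.

(** * The integral *)

(** The approximation of zeta at [N = n + 2], multiplied by [v / cosh (pi v)] and arranged so that
    each summand has one of the transforms computed above. *)
Definition approx_integrand (n : nat) (v : R) : R :=
  sum_n (fun k => - exp (- (ln (INR k + 1) / 2)) * (v * sin (ln (INR k + 1) * v) / cosh (PI * v))) (S n)
  - main_integrand (ln (INR n + 2)) v / cosh (PI * v).

Lemma approx_integrand_eq (n : nat) (v : R) :
  approx_integrand n v = (sum_n (fun k => npow_im v (1 / 2) (INR k + 1)) (S n)
     - npow_im_primitive v (1 / 2) (INR n + 2)) / cosh (PI * v) * v.
Proof.
  pose proof (cosh_pos (PI * v)) as Hc; pose proof (quarter_plus_sqr_pos v) as Hq.
  unfold approx_integrand.
  rewrite (sum_n_Rext _ (fun k => v / cosh (PI * v) * npow_im v (1 / 2) (INR k + 1))).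
  - rewrite sum_n_Rmult_l.
    replace (main_integrand (ln (INR n + 2)) v) with (npow_im_primitive v (1 / 2) (INR n + 2) * v).
    + field; lra.
    + unfold main_integrand, npow_im_primitive.
      replace ((1 - 1 / 2) * ln (INR n + 2)) with (ln (INR n + 2) / 2) by field.
      rewrite (Rmult_comm v (ln _)).
      replace ((1 - 1 / 2) ^ 2 + v ^ 2) with (/ 4 + v ^ 2) by field.
      field; nra.
  - intros k; unfold npow_im.
    replace (- (1 / 2) * ln (INR k + 1)) with (- (ln (INR k + 1) / 2)) by field.
    rewrite (Rmult_comm v (ln _)); field; lra.
Qed.

Lemma approx_integral (n : nat) :
  is_RInt_0_infty (approx_integrand n)
    (sum_n (fun k => - (INR k / (2 * (INR k + 2) ^ 2))) (S n)
     - (1 - ln (INR (S n) + 2) / 2 - / (INR (S n) + 2))).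
Proof.
  apply is_RInt_0_infty_minus.
  - apply (is_RInt_0_infty_sum (fun k v => - exp (- (ln (INR k + 1) / 2))
                                  * (v * sin (ln (INR k + 1) * v) / cosh (PI * v)))).
    intros k; pose proof (pos_INR k) as Hk; set (l := ln (INR k + 1)).
    replace (- (INR k / (2 * (INR k + 2) ^ 2)))
      with (- exp (- (l / 2)) * (sinh (l / 2) / (4 * cosh (l / 2) ^ 2))).
    + apply is_RInt_0_infty_scal, sine_sech_transform.
    + unfold sinh, cosh; rewrite exp_Ropp; set (u := exp (l / 2)).
      assert (Hu : 0 < u) by apply exp_pos.
      assert (E : INR k = u * u - 1).
      { unfold u; rewrite <- exp_plus; replace (l / 2 + l / 2) with l by field.
        unfold l; rewrite exp_ln; lra. }
      rewrite E; field; nra.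
  - pose proof (pos_INR n).
    (* At [a = ln (n + 2)] the quantity [1 + exp a] is [n + 3], which is why the value is the
       sequence of [partial_value_limit] at [S n]. *)
    replace (INR (S n) + 2) with (1 + exp (ln (INR n + 2))).
    + apply main_integral.
    + rewrite exp_ln, S_INR; lra.
Qed.

Lemma ex_RInt_approx_integrand (n : nat) (b : R) : ex_RInt (approx_integrand n) 0 b.
Proof.
  apply (@ex_RInt_minus R_NormedModule).
  - eexists; apply (is_RInt_sum_n (fun k v => - exp (- (ln (INR k + 1) / 2))
                                  * (v * sin (ln (INR k + 1) * v) / cosh (PI * v)))).
    intros k; apply (@RInt_correct R_CompleteNormedModule), (@ex_RInt_scal R_NormedModule).
    apply (@ex_RInt_continuous R_CompleteNormedModule); intros v _.
    apply (continuous_div_cosh (fun v => v * sin (ln (INR k + 1) * v))).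
    apply (ex_derive_continuous (fun v => v * sin (ln (INR k + 1) * v))); now auto_derive.
  - apply (@ex_RInt_continuous R_CompleteNormedModule); intros v _.
    apply continuous_div_cosh, continuous_main_integrand.
Qed.

Lemma cosh_PI_abs (v : R) : cosh (PI * v) = cosh (PI * Rabs v).
Proof.
  unfold Rabs; destruct (Rcase_abs v); [|reflexivity].
  unfold cosh; replace (PI * - v) with (- (PI * v)) by ring; rewrite Ropp_involutive; lra.
Qed.

(** The case [v = 0], outside [Im_zeta_approx], is saved by the factor [v]. The bound covers
    negative [v] too, because it later serves as uniform convergence on the whole line. *)
Lemma approx_integrand_error (zeta : C -> C) (n : nat) (v : R) :
  is_riemann_zeta zeta ->
  Rabs (Im (zeta (1 / 2, v)) / cosh (PI * v) * v - approx_integrand n v)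
  <= 4 * exp (- (/ 4) * ln (INR (S n) + 1)) * 2 * exp (- (1) * Rabs v).
Proof.
  intros Hz; rewrite approx_integrand_eq.
  set (E := exp (- (/ 4) * ln (INR (S n) + 1))).
  assert (HE : 0 < E) by apply exp_pos.
  destruct (Req_dec v 0) as [H0|Hv].
  - rewrite H0, !Rmult_0_r, Rminus_diag, Rabs_R0.
    apply Rmult_le_pos; [lra|left; apply exp_pos].
  - pose proof (Im_zeta_approx zeta v (1 / 2) n Hz Hv ltac:(lra)) as H.
    set (A := sum_n _ _ - _) in *; pose proof (cosh_pos (PI * v)) as Hc.
    replace (Im (zeta (1 / 2, v)) / cosh (PI * v) * v - A / cosh (PI * v) * v)
      with ((Im (zeta (1 / 2, v)) - A) * v / cosh (PI * v)) by (field; lra).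
    rewrite (cosh_PI_abs v).
    pose proof (Rabs_pos v) as Hv0.
    apply abs_div_cosh_le; [exact Hv0|].
    rewrite Rabs_mult.
    assert (EB : tail_bound v (1 / 2) (S n) = 4 * E * (1 + Rabs v)).
    { unfold tail_bound, E; replace (- (1 / 2 / 2)) with (- (/ 4)) by field; field. }
    rewrite EB in H.
    apply Rle_trans with (4 * E * (1 + Rabs v) * Rabs v); [now apply Rmult_le_compat_r|].
    assert (0 <= E * (1 + Rabs v)) by (apply Rmult_le_pos; lra); simpl; nra.
Qed.

Lemma approx_error_lim : is_lim_seq (fun n => 4 * exp (- (/ 4) * ln (INR (S n) + 1)) * 2) 0.
Proof.
  apply is_lim_seq_ext with (fun n => 8 * exp (- (/ 4) * ln (INR (S n) + 1))); [intros; ring|].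
  replace (Finite 0) with (Rbar_mult 8 0) by (simpl; f_equal; ring).
  apply is_lim_seq_scal_l, (is_lim_seq_incr_1 (fun n => exp (- (/ 4) * ln (INR n + 1)))).
  apply is_lim_seq_exp_ln; lra.
Qed.

(** Integrability is inherited from the approximants, which converge uniformly. *)
Lemma ex_RInt_zeta_integrand (zeta : C -> C) (b : R) :
  is_riemann_zeta zeta -> ex_RInt (fun v => Im (zeta (1 / 2, v)) / cosh (PI * v) * v) 0 b.
Proof.
  intros Hz.
  destruct (@filterlim_RInt nat R_CompleteNormedModule approx_integrand 0 b eventually _
    (fun v => Im (zeta (1 / 2, v)) / cosh (PI * v) * v)
    (fun n => RInt (approx_integrand n) 0 b)) as [l [_ Hl]].
  - intros n; apply (@RInt_correct R_CompleteNormedModule), ex_RInt_approx_integrand.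
  - intros P [eps HP].
    pose proof approx_error_lim as Herr; apply is_lim_seq_spec in Herr.
    destruct (Herr eps) as [N HN]; exists N; intros n Hn; apply HP; intros v.
    specialize (HN n Hn); rewrite Rminus_0_r in HN.
    change (Rabs (approx_integrand n v - Im (zeta (1 / 2, v)) / cosh (PI * v) * v) < eps).
    rewrite Rabs_minus_sym.
    eapply Rle_lt_trans; [now apply approx_integrand_error|].
    set (E := 4 * exp (- (/ 4) * ln (INR (S n) + 1)) * 2) in *.
    pose proof (Rle_abs E); pose proof (exp_pos (- (1) * Rabs v)).
    assert (0 <= E) by (unfold E; pose proof (exp_pos (- (/ 4) * ln (INR (S n) + 1))); lra).
    assert (exp (- (1) * Rabs v) <= 1).
    { rewrite <- exp_0 at 2; apply exp_le; pose proof (Rabs_pos v); lra. }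
    apply Rle_lt_trans with (E * 1); [now apply Rmult_le_compat_l|lra].
  - now exists l.
Qed.

Theorem mainTheorem9 (zeta : C -> C) (Hzeta : is_riemann_zeta zeta) :
  is_RInt_gen
    (fun v : R => Im (zeta (RtoC (1 / 2) + Ci * RtoC v)%C) / cosh (PI * v) * v)
    (at_point 0) (Rbar_locally p_infty)
    (- (3 / 2) + PI ^ 2 / 6 - euler_gamma / 2).
Proof.
  set (f := fun v => Im (zeta (1 / 2, v)) / cosh (PI * v) * v).
  assert (Herr : forall n v, 0 <= v -> Rabs (f v - approx_integrand n v)
            <= 4 * exp (- (/ 4) * ln (INR (S n) + 1)) * 2 * exp (- (1) * v)).
  { intros n v Hv; pose proof (approx_integrand_error zeta n v Hzeta) as H.
    now rewrite (Rabs_pos_eq v) in H. }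
  (* The difference from one approximant is exponentially dominated, and that approximant has a
     known integral; together they give the existence of the integral of [f]. *)
  destruct (ex_RInt_0_infty_dominated (fun v => f v - approx_integrand 0 v)
              (4 * exp (- (/ 4) * ln (INR 1 + 1)) * 2) 1) as [l0 Hl0].
  - lra.
  - intros b _; apply (@ex_RInt_minus R_NormedModule);
      [now apply ex_RInt_zeta_integrand|apply ex_RInt_approx_integrand].
  - exact (Herr O).
  - pose proof (is_RInt_0_infty_plus _ _ _ _ Hl0 (approx_integral 0)) as Hf.
    set (l := l0 + _) in Hf.
    apply (is_RInt_0_infty_ext _ f) in Hf; [|intros v _; ring].
    set (s := fun n => sum_n (fun k => - (INR k / (2 * (INR k + 2) ^ 2))) n
                       - (1 - ln (INR n + 2) / 2 - / (INR n + 2))).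
    (* The integral [l] differs from the exact value [s (S n)] by at most [8 (n + 2) ^ (- 1/4)], so
       it is the limit of [s]. *)
    assert (Hs : is_lim_seq s l).
    { apply is_lim_seq_incr_1.
      apply is_lim_seq_ext with (fun n => l - (l - s (S n))); [intros; ring|].
      replace (Finite l) with (Finite (l - 0)) by (f_equal; ring).
      apply is_lim_seq_minus'; [apply is_lim_seq_const|].
      apply is_lim_seq_abs_0.
      apply is_lim_seq_le_le with (3 := approx_error_lim) (u := fun _ => 0); [|apply is_lim_seq_const].
      intros n; split; [apply Rabs_pos|].
      rewrite <- (Rdiv_1_r (4 * _ * 2)).
      apply is_RInt_0_infty_abs_le with (2 := Herr n); [lra|].
      apply is_RInt_0_infty_minus; [exact Hf|apply approx_integral]. }
    rewrite <- (partial_value_limit l Hs).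
    apply (is_RInt_0_infty_ext f); [|exact Hf].
    intros v _; unfold f.
    replace (RtoC (1 / 2) + Ci * RtoC v)%C with (1 / 2, v); [reflexivity|].
    unfold RtoC, Ci, Cplus, Cmult; simpl; f_equal; field.
Qed.
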